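(* Let $n \geq 6$ be an even integer. Then $R(W_n, S_n) = \frac{5n}{2} - 2$ or $R(W_n,S_n) = \frac{5n}{2} - 1$.
   Context: All graphs are finite and simple. $\overline{G}$ denotes the complement of a graph $G$. For two graphs $G_1$ and $G_2$, the Ramsey number $R(G_1,G_2)$ is the smallest positive integer $N$ such that for every graph $G$ on $N$ vertices, $G$ contains $G_1$ as a subgraph (not necessarily induced) or $\overline{G}$ contains $G_2$ as a subgraph (not necessarily induced). The wheel $W_m$ is the graph on $m+1$ vertices obtained from the cycle $C_m$ on $m$ vertices by adding one new vertex adjacent to every vertex of $C_m$. The star $S_n$ is the complete bipartite graph $K_{1,n-1}$, which has $n$ vertices. *)

(* Defs.v *)
(* MathComp *)
From mathcomp Require Import all_boot.

Set Implicit Arguments.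
Unset Strict Implicit.
Unset Printing Implicit Defensive.

Record sgraph (T : finType) := SGraph {
  adj :> rel T;
  adj_sym : symmetric adj;
  adj_irr : irreflexive adj }.

Section Complement.
Variables (T : finType) (G : sgraph T).

Definition co_adj : rel T := fun x y => (x != y) && ~~ G x y.

Lemma co_adj_sym : symmetric co_adj.
Proof. by move=> x y; rewrite /co_adj eq_sym adj_sym. Qed.

Lemma co_adj_irr : irreflexive co_adj.
Proof. by move=> x; rewrite /co_adj eqxx. Qed.

Definition complement : sgraph T := SGraph co_adj_sym co_adj_irr.

End Complement.

(* G contains a copy of H as a subgraph, not necessarily induced. *)
Definition contains (S T : finType) (G : sgraph T) (H : sgraph S) : Prop :=
  exists2 f : S -> T, injective f & forall x y, H x y -> G (f x) (f y).

Definition ramsey_prop (S1 S2 : finType) (G1 : sgraph S1) (G2 : sgraph S2)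
    (N : nat) : Prop :=
  forall (T : finType) (G : sgraph T), #|T| = N ->
    contains G G1 \/ contains (complement G) G2.

(* R(G1, G2) = N, stated as a relation so that it does not presuppose the
   existence of the Ramsey number. *)
Definition is_ramsey_number (S1 S2 : finType) (G1 : sgraph S1)
    (G2 : sgraph S2) (N : nat) : Prop :=
  [/\ 0 < N, ramsey_prop G1 G2 N
    & forall M, 0 < M -> ramsey_prop G1 G2 M -> N <= M].

Section Cycle.
Variable m : nat.

(* ordS is the successor modulo m; this is the usual cycle when 3 <= m. *)
Definition cycle_adj : rel 'I_m :=
  fun i j => (i != j) && ((j == ordS i) || (i == ordS j)).

Lemma cycle_adj_sym : symmetric cycle_adj.
Proof. by move=> i j; rewrite /cycle_adj eq_sym orbC. Qed.

Lemma cycle_adj_irr : irreflexive cycle_adj.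
Proof. by move=> i; rewrite /cycle_adj eqxx. Qed.

Definition cycle_graph : sgraph 'I_m := SGraph cycle_adj_sym cycle_adj_irr.

(* None is the hub, and the Some i are the rim vertices. *)
Definition wheel_adj : rel (option 'I_m) := fun u v =>
  match u, v with
  | Some i, Some j => cycle_graph i j
  | None, None => false
  | _, _ => true
  end.

Lemma wheel_adj_sym : symmetric wheel_adj.
Proof. by move=> [i|] [j|] //=; apply: cycle_adj_sym. Qed.

Lemma wheel_adj_irr : irreflexive wheel_adj.
Proof. by move=> [i|] //=; apply: cycle_adj_irr. Qed.

Definition wheel : sgraph (option 'I_m) := SGraph wheel_adj_sym wheel_adj_irr.

End Cycle.

Section CompleteBipartite.
Variables a b : nat.

Definition bipartite_adj : rel ('I_a + 'I_b)%type := fun u v =>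
  match u, v with
  | inl _, inr _ | inr _, inl _ => true
  | _, _ => false
  end.

Lemma bipartite_adj_sym : symmetric bipartite_adj.
Proof. by move=> [i|i] [j|j]. Qed.

Lemma bipartite_adj_irr : irreflexive bipartite_adj.
Proof. by move=> [i|i]. Qed.

Definition complete_bipartite : sgraph ('I_a + 'I_b)%type :=
  SGraph bipartite_adj_sym bipartite_adj_irr.

End CompleteBipartite.

(* The index counts all vertices, the centre included (for 0 < n). *)
Definition star (n : nat) : sgraph ('I_1 + 'I_n.-1)%type :=
  complete_bipartite 1 n.-1.

(* Main.v *)
Require Import Defs.
From Stdlib Require Import Classical.
From mathcomp Require Import all_boot zify.

(** Write n = 2m, so that the two candidate values are 5m - 2 and 5m - 1. The
    complement of G contains no star S_n exactly when every vertex of G has at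
    most 2m - 2 non-neighbours, and G contains W_n exactly when the
    neighbourhood of some vertex contains a cycle of length 2m.

    Lower bound ([ramsey_lower]). Join an independent set of 2m - 1 vertices to
    the disjoint union of K_m and K_{m-1,m-1}. This graph has 5m - 3 vertices
    and every vertex has 2m - 2 non-neighbours. The neighbourhood of an
    independent vertex has only components of fewer than 2m vertices; any other
    neighbourhood has only m - 1 vertices outside the independent set, too few
    for a cycle of length 2m.

    Upper bound ([ramsey_prop_wheel_star]). Let G have 5m - 1 vertices, each
    with at most 2m - 2 non-neighbours, and suppose that no neighbourhood
    contains a cycle of length 2m. A neighbourhood N(v) has at least 3m
    vertices, and inside it every degree is at least m + 1.

    - An independent set A of m vertices in N(v) would lie on a cycle of length
      2m that alternates between A and N(v) \ A ([alternating_cycle]), because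
      every vertex of A misses at most m - 1 vertices of N(v) \ A. So
      independent sets in N(v) have fewer than m vertices ([stable_nbh]).

    - By the method of Chvatal and Erdos, a graph whose connectivity exceeds its
      independence number has a Hamilton path between any two adjacent vertices
      ([ham_connected]). Hence neighbourhoods have to be shown highly connected,
      that is, two disjoint sets K1, K2 without edges between them have to be
      shown small. If x and p are adjacent vertices of K1 then both miss K2, so
      p sees all but a few vertices of N(x). Such a vertex p turns any cycle of
      N(x) - p with at least 2m - 1 vertices into one of length exactly 2m
      ([cycle_arc]). Three such vertices force a long cycle by rotating longest
      paths ([long_cycle]), whence #|K1| + #|K2| <= 2m + 1 ([separated_le]).
      This makes N(x) + x Hamilton-connected, which excludes even one such p
      ([nonadjacent_many]) and gives #|K1| + #|K2| < 2m ([separated_lt]).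

    - Now N(v) - p has a Hamilton cycle for every p in N(v), so by [cycle_arc]
      p sees less than half of N(v). Consequently two adjacent vertices have at
      most (m - 3) / 2 common non-neighbours ([common_nonadjacent]).

    - Finally take 3m vertices of N(v), a triangle x, y, z among them, and a
      Hamilton path from y to z avoiding x. If x sees the j-th vertex of this
      path, then in the resulting Hamilton cycle one can leave out the m
      vertices that follow it, unless the vertex after those is a common
      non-neighbour of the first two vertices of the path ([window]). So x has
      at most (m - 3) / 2 neighbours among the first 2m - 3 inner vertices of
      the path, and likewise among the last 2m - 3. These cover the inner
      vertices, so x has at most m - 1 neighbours, although its degree is at
      least m + 1. *)

Set Implicit Arguments.
Unset Strict Implicit.
Unset Printing Implicit Defensive.

(** The same size or cardinal may occur with the carrier of the finite type and
    with that of its underlying equality type, which are distinct atoms for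
    [lia]; forgetting everything but the linear hypotheses keeps it fast. *)
Ltac flia :=
  repeat match goal with
  | H : is_true (leq _ _) |- _ => revert H
  | H : is_true (andb (leq _ _) (leq _ _)) |- _ => revert H
  | H : @eq nat _ _ |- _ => revert H
  end;
  repeat match goal with
  | |- context [Equality.sort (fintype_Finite__to__eqtype_Equality ?U)] =>
    change (Equality.sort (fintype_Finite__to__eqtype_Equality U))
      with (Finite.sort U)
  end;
  clear; intros; lia.

(** * Arcs of cycles *)

Section Paths.
Variables (T : finType) (G : sgraph T).
Implicit Types (x y : T) (s c : seq T).

Lemma rev_sortedG s : sorted G (rev s) = sorted G s.
Proof. by rewrite rev_sorted; apply: eq_sorted => x y; rewrite adj_sym. Qed.

Lemma sorted_join x0 s1 s2 :
    sorted G s1 -> sorted G s2 ->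
    (s1 != [::] -> s2 != [::] -> G (last x0 s1) (head x0 s2)) ->
  sorted G (s1 ++ s2).
Proof.
case: s1 => [|x s1] //=; case: s2 => [|y s2] /=; first by rewrite cats0.
by rewrite cat_path /= => -> -> ->.
Qed.

Lemma sorted_cycle x0 s :
  sorted G s -> G (last x0 s) (head x0 s) -> cycle G s.
Proof. by case: s => //= x s; rewrite rcons_path => -> ->. Qed.

Lemma cycle_sorted s : cycle G s -> sorted G s.
Proof. by case: s => //= x s; rewrite rcons_path => /andP[]. Qed.

Lemma last_take x0 k s : 0 < k <= size s -> last x0 (take k s) = nth x0 s k.-1.
Proof.
move=> /andP[k0 ks]; rewrite -nth_last size_take_min (minn_idPl ks) nth_take //.
by rewrite prednK.
Qed.

Lemma head_drop x0 k s : head x0 (drop k s) = nth x0 s k.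
Proof. by rewrite -nth0 nth_drop addn0. Qed.

Lemma head_take x0 k s : 0 < k -> head x0 (take k s) = head x0 s.
Proof. by case: s k => [|a s] [|k]. Qed.

Lemma head_rev x0 s : head x0 (rev s) = last x0 s.
Proof. by case/lastP: s => [|s y] //; rewrite rev_rcons last_rcons. Qed.

Lemma last_rev x0 s : last x0 (rev s) = head x0 s.
Proof. by rewrite -{2}(revK s) head_rev. Qed.

Lemma last_drop x0 k s : k < size s -> last x0 (drop k s) = last x0 s.
Proof.
by move=> ks; rewrite -[in RHS](cat_take_drop k s) last_cat (drop_nth x0 ks).
Qed.

Lemma nth_rotC x0 i j s :
  i < size s -> j < size s -> nth x0 (rot i s) j = nth x0 (rot j s) i.
Proof.
move=> ik js; rewrite /rot !nth_cat !size_drop !nth_drop addnC.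
case: ltnP => h; case: ltnP => h' //; try by (exfalso; lia).
by rewrite !nth_take; try lia; congr nth; lia.
Qed.

Lemma count_nth x0 (a : pred T) s :
  count a s = count (fun i => a (nth x0 s i)) (iota 0 (size s)).
Proof. by rewrite -{1}(mkseq_nth x0 s) count_map. Qed.

Lemma count_sub_in (I : eqType) (a b : pred I) (r : seq I) :
  {in r, forall i, a i -> b i} -> count a r <= count b r.
Proof.
elim: r => //= i r IH ab; apply: leq_add; last first.
  by apply: IH => j jr; apply: ab; rewrite inE jr orbT.
by have := ab i (mem_head _ _); case: (a i) => // ->.
Qed.

(** The neighbours of x fill more than half of the cycle, so they meet their own
    translate by k - 1 positions: the arc of k vertices between two neighbours
    of x is closed by x. *)
Lemma cycle_arc c x k :
    uniq c -> cycle G c -> x \notin c -> size c < 2 * count (G x) c ->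
    0 < k <= size c ->
  exists s, [/\ uniq s, cycle G s, size s = k.+1 & {subset s <= x :: c}].
Proof.
move=> Uc Cc xc lt_c /andP[k0 kc].
have [i ic /andP[xi xik]] : exists2 i, i < size c &
    G x (nth x c i) && G x (nth x (rot k.-1 c) i).
  have : has (predI (fun i => G x (nth x c i))
      (fun i => G x (nth x (rot k.-1 c) i))) (iota 0 (size c)).
    rewrite has_count.
    have := count_predUI (fun i => G x (nth x c i))
      (fun i => G x (nth x (rot k.-1 c) i)) (iota 0 (size c)).
    have := count_nth x (G x) c.
    have := count_nth x (G x) (rot k.-1 c).
    rewrite size_rot (permP (_ : perm_eq (rot k.-1 c) c)) ?perm_rot //.
    have := count_size (predU (fun i => G x (nth x c i))
      (fun i => G x (nth x (rot k.-1 c) i))) (iota 0 (size c)).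
    rewrite size_iota => leU <- <- eqUI.
    rewrite -(ltn_add2l (count (predU (fun i => G x (nth x c i))
      (fun i => G x (nth x (rot k.-1 c) i))) (iota 0 (size c)))) addn0 eqUI.
    by rewrite addnn -mul2n; apply: leq_ltn_trans lt_c.
  by case/hasP => i; rewrite mem_iota => /andP[_ /= ic] h; exists i.
have kc' : k.-1 < size c by lia.
have krot : k <= size (rot i c) by rewrite size_rot.
exists (x :: take k (rot i c)); split.
- rewrite /= take_uniq ?rot_uniq // andbT.
  by apply: contra xc => /mem_take; rewrite mem_rot.
- apply: (sorted_cycle (x0 := x)).
    rewrite -cat1s; apply: (sorted_join (x0 := x)) => // [|_ _].
      by apply: take_sorted; apply: cycle_sorted; rewrite rot_cycle.
    by rewrite head_take // -nth0 nth_rotC // ?rot0 //; lia.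
  rewrite /= -[last x (take _ _)]/(last x (take k (rot i c))) last_take ?k0 //.
  by rewrite nth_rotC // adj_sym.
- by rewrite /= size_takel.
- move=> z; rewrite !inE => /orP[->//|/mem_take].
  by rewrite mem_rot => ->; rewrite orbT.
Qed.


(** * Hamilton-connected graphs *)

Definition stable (I : {set T}) := {in I &, forall x y, ~~ G x y}.

Definition separated (K1 K2 : {set T}) :=
  [/\ K1 != set0, K2 != set0, [disjoint K1 & K2]
    & {in K1 & K2, forall x y, ~~ G x y}].

Definition same_ends x0 (P P' : seq T) :=
  head x0 P' = head x0 P /\ last x0 P' = last x0 P.

Section Detour.
Variables (x0 : T) (P q : seq T).
Hypotheses (uP : uniq P) (sP : sorted G P) (uq : uniq q) (sq : sorted G q).
Hypotheses (q0 : q != [::]) (Pq : ~~ has [in P] q).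

Lemma insert_path i :
    i.+1 < size P -> G (nth x0 P i) (head x0 q) ->
    G (last x0 q) (nth x0 P i.+1) ->
  exists P', [/\ uniq P', sorted G P', {subset P' <= P ++ q},
    same_ends x0 P P' & size P < size P'].
Proof.
move=> iP Gi Gj; pose P' := take i.+1 P ++ q ++ drop i.+1 P.
have eP' : perm_eq P' (P ++ q).
  by rewrite /P' perm_catCA perm_sym perm_catC cat_take_drop.
exists P'; split.
- by rewrite (perm_uniq eP') cat_uniq uP Pq uq.
- apply: (sorted_join (x0 := x0)); first exact: take_sorted.
    apply: (sorted_join (x0 := x0)) => //; first exact: drop_sorted.
    by rewrite head_drop.
  move=> _ _; rewrite last_take /=; last by flia.
  by rewrite -nth0 nth_cat lt0n size_eq0 q0 nth0.
- by move=> z; rewrite (perm_mem eP').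
- split; first by rewrite /P'; case: (P) iP.
  by rewrite -[RHS](last_drop x0 iP) !last_cat (drop_nth x0 iP).
- by rewrite (perm_size eP') size_cat -addn1 leq_add2l lt0n size_eq0.
Qed.

Lemma reroute_path i j :
    i < j -> j.+1 < size P -> G (nth x0 P i) (head x0 q) ->
    G (last x0 q) (nth x0 P j) -> G (nth x0 P i.+1) (nth x0 P j.+1) ->
  exists P', [/\ uniq P', sorted G P', {subset P' <= P ++ q},
    same_ends x0 P P' & size P < size P'].
Proof.
move=> ij jP Gi Gj Gij; pose M := drop i.+1 (take j.+1 P).
have M0 : M != [::] by rewrite -size_eq0 size_drop size_takel; flia.
have hM : head x0 M = nth x0 P i.+1 by rewrite head_drop nth_take.
have lM : last x0 M = nth x0 P j.
  by rewrite last_drop ?size_takel ?last_take //=; flia.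
have eM : take i.+1 P ++ M = take j.+1 P.
  by rewrite /M -[take i.+1 P](@take_takel _ i.+1 j.+1) ?cat_take_drop //; flia.
pose P' := take i.+1 P ++ q ++ rev M ++ drop j.+1 P.
have eP' : perm_eq P' (P ++ q).
  rewrite /P' perm_catCA perm_sym perm_catC perm_cat2l.
  rewrite -{1}(cat_take_drop j.+1 P) -eM -catA perm_cat2l perm_cat2r.
  by rewrite perm_sym perm_rev.
have rM0 : rev M != [::] by rewrite -size_eq0 size_rev size_eq0.
exists P'; split.
- by rewrite (perm_uniq eP') cat_uniq uP Pq uq.
- apply: (sorted_join (x0 := x0)); first exact: take_sorted.
    apply: (sorted_join (x0 := x0)) => //.
      apply: (sorted_join (x0 := x0)); last by rewrite head_drop last_rev hM.
        by rewrite rev_sortedG; apply/drop_sorted/take_sorted.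
      exact: drop_sorted.
    move=> _ _; rewrite -nth0 nth_cat lt0n size_eq0 rM0 nth0 head_rev lM //.
  move=> _ _; rewrite last_take /=; last by flia.
  by rewrite -nth0 nth_cat lt0n size_eq0 q0 nth0.
- by move=> z; rewrite (perm_mem eP').
- split; first by rewrite /P'; case: (P) jP.
  by rewrite -[RHS](last_drop x0 jP) !last_cat (drop_nth x0 jP).
- by rewrite (perm_size eP') size_cat -addn1 leq_add2l lt0n size_eq0.
Qed.

End Detour.

(** The first hypothesis says that no set of fewer than k vertices separates S.
    Let D be the component of d off the path P and A the set of vertices of P
    with a neighbour in D. If P cannot be rerouted through D then no vertex of A
    is followed by another one, so A separates D from the rest of S and has at
    least k elements; moreover the successors of A are pairwise non-adjacent
    and, together with d, form an independent set that is too large. *)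
Lemma longer_path (S : {set T}) k P d :
    (forall K1 K2 : {set T}, K1 \subset S -> K2 \subset S -> separated K1 K2 ->
       #|K1| + #|K2| + k <= #|S|) ->
    (forall I : {set T}, I \subset S -> stable I -> #|I| < k) ->
    1 < size P -> uniq P -> sorted G P -> {subset P <= S} ->
    d \in S -> d \notin P ->
  exists P', [/\ uniq P', sorted G P', {subset P' <= S},
    same_ends d P P' & size P < size P'].
Proof.
move=> hsep hst P1 uP sP PS dS dP.
pose R := S :\: [set x in P].
pose r := [rel a b | [&& G a b, a \in R & b \in R]].
have rsym : connect_sym r.
  apply: sym_connect_sym => a b /=.
  by rewrite adj_sym; congr (_ && _); rewrite andbC.
pose D := [set w | connect r d w].
have dR : d \in R by rewrite !inE dP dS.
have pathR a s : a \in R -> path r a s -> {subset a :: s <= R}.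
  elim: s a => [|b s IH] a aR /=; first by move=> _ z; rewrite inE => /eqP->.
  case/andP => /and3P[_ _ bR] /(IH _ bR) sub z; rewrite inE => /orP[/eqP-> //|].
  exact: sub.
have DR : D \subset R.
  apply/subsetP => w; rewrite inE => /connectP[s ps ->].
  by apply: (pathR _ _ dR ps); apply: mem_last.
have Dq a b : a \in D -> b \in D -> exists q, [/\ uniq q, sorted G q, q != [::],
    {subset q <= R} & head d q = a /\ last d q = b].
  move=> aD bD; have aR := subsetP DR _ aD; rewrite !inE in aD bD.
  have : connect r a b by apply: connect_trans bD; rewrite rsym.
  case/connectP => s0 ps0 ->; case/shortenP: ps0 => s ps us _.
  exists (a :: s); split => //; last exact: pathR.
  by apply: sub_path ps => u v /= /and3P[].
pose A := [set v in P | [exists a in D, G v a]].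
have goodq (q : seq T) : {subset q <= R} -> ~~ has [in P] q.
  move=> qR; apply/hasPn => z /qR; rewrite !inE => /andP[] //.
have subS (q P' : seq T) : {subset q <= R} -> {subset P' <= P ++ q} -> {subset P' <= S}.
  move=> qR sub z /sub; rewrite mem_cat => /orP[/PS //|/qR].
  by rewrite !inE => /andP[].
have inA v : v \in A -> exists2 a, a \in D & G v a.
  by rewrite inE => /andP[_ /existsP[a /andP[]]]; exists a.
(* an excursion into D between consecutive vertices of A lengthens P *)
case: (boolP [exists i : 'I_(size P), [&& i.+1 < size P, nth d P i \in A
    & nth d P i.+1 \in A]]).
  case/existsP => i /and3P[iP /inA[a aD Ga] /inA[b bD Gb]].
  have [q [uq sq q0 qR [hq lq]]] := Dq a b aD bD.
  have [] := insert_path (x0 := d) uP sP uq sq q0 (goodq q qR) iP.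
  - by rewrite hq.
  - by rewrite lq adj_sym.
  move=> P' [uP' sP' sub ends szP']; exists P'; split=> //; exact: (subS q P' qR sub).
move=> noconsec.
(* if the successors of two vertices of A are adjacent, then P can be cut at
   both places, linked through D, and the segment between them reversed *)
case: (boolP [exists i : 'I_(size P), [exists j : 'I_(size P),
    [&& i < j, j.+1 < size P, nth d P i \in A, nth d P j \in A
    & G (nth d P i.+1) (nth d P j.+1)]]]).
  case/existsP => i /existsP[j /and5P[ij jP /inA[a aD Ga] /inA[b bD Gb] Gij]].
  have [q [uq sq q0 qR [hq lq]]] := Dq a b aD bD.
  have [] := reroute_path (x0 := d) uP sP uq sq q0 (goodq q qR) ij jP.
  - by rewrite hq.
  - by rewrite lq adj_sym.
  - by [].
  move=> P' [uP' sP' sub ends szP']; exists P'; split=> //; exact: (subS q P' qR sub).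
move=> nocross; exfalso.
have nextA i : i.+1 < size P -> nth d P i \in A -> nth d P i.+1 \notin A.
  move=> iP iA; apply: contra noconsec => jA; have iP' : i < size P by flia.
  by apply/existsP; exists (Ordinal iP'); rewrite /= iP iA.
have AP v : v \in A -> v \in P by rewrite inE => /andP[].
have kA : k <= #|A|.
  have sepDA : separated D (S :\: (D :|: A)).
    split.
    - by apply/set0Pn; exists d; rewrite inE connect0.
    - apply/set0Pn; have notA : exists2 v, v \in P & v \notin A.
        case: (boolP (nth d P 0 \in A)) => [/(nextA 0 P1)|]; last first.
          by exists (nth d P 0) => //; apply: mem_nth; flia.
        by exists (nth d P 1) => //; apply: mem_nth.
      case: notA => v vP vA; exists v.
      have vD : v \notin D by apply/negP => /(subsetP DR); rewrite !inE vP.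
      by rewrite in_setD in_setU negb_or vD vA PS.
    - by rewrite -setI_eq0; apply/eqP/setP => z; rewrite !inE; case: connect.
    move=> a b aD; rewrite !inE negb_or -!andbA => /and3P[bD bA bS].
    apply/negP => Gab; case/negP: bD; case: (boolP (b \in P)) => bP.
      case/negP: bA; rewrite bP /=; apply/existsP; exists a.
      by rewrite aD adj_sym.
    have aR := subsetP DR _ aD; rewrite inE in aD.
    apply: connect_trans aD _; apply: connect1 => /=.
    by rewrite Gab aR !inE bP bS.
  have := hsep _ _ (subset_trans DR (subsetDl _ _)) (subsetDl _ _) sepDA.
  have -> : #|S :\: (D :|: A)| = #|S| - #|D| - #|A|.
    rewrite cardsDS; last first.
      rewrite subUset (subset_trans DR (subsetDl _ _)).
      by apply/subsetP => v /AP /PS.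
    rewrite cardsU (_ : D :&: A = set0) ?cards0; first by flia.
    apply/setP => v; rewrite [RHS]inE; apply/negP; rewrite in_setI.
    by case/andP => /(subsetP DR); rewrite !inE => /andP[/negbTE-> _].
  have : #|D| + #|A| <= #|S|.
    rewrite -cardsUI (_ : D :&: A = set0) ?cards0 ?addn0.
      apply: subset_leq_card.
      rewrite subUset (subset_trans DR (subsetDl _ _)).
      by apply/subsetP => v /AP /PS.
    apply/setP => v; rewrite [RHS]inE; apply/negP; rewrite in_setI.
    by case/andP => /(subsetP DR); rewrite !inE => /andP[/negbTE-> _].
  by flia.
(* the last vertex of P has no successor, which costs one element; d makes up
   for it *)
pose nx v := nth d P (index v P).+1.
pose A' := A :\ last d P.
have A'idx v : v \in A' -> [/\ (index v P).+1 < size P,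
    nth d P (index v P) = v, v \in A & v \in P].
  rewrite inE in_set1 => /andP[vl vA]; have vP := AP _ vA; split => //.
    rewrite ltn_neqAle index_mem vP andbT; apply: contra vl => /eqP e.
    by rewrite -nth_last -e /= nth_index.
  by rewrite nth_index.
have nxinj : {in A' &, injective nx}.
  move=> u v /A'idx[u1 u2 _ _] /A'idx[v1 v2 _ _] /eqP.
  by rewrite /nx nth_uniq // => /eqP[] e; rewrite -u2 -v2 e.
pose I := d |: nx @: A'.
have dnx : d \notin nx @: A'.
  apply: contra dP => /imsetP[v /A'idx[v1 _ _ _] ->]; exact: mem_nth.
have : #|I| < k.
  apply: hst.
    apply/subsetP => z /setU1P[-> //|/imsetP[v /A'idx[v1 _ _ _] ->]].
    by apply: PS; apply: mem_nth.
  have dnxn v : v \in A' -> ~~ G d (nx v).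
    move=> /A'idx[v1 v2 vA vP]; apply/negP => Gd.
    have := nextA _ v1; rewrite v2 => /(_ vA) /negP; apply.
    rewrite inE mem_nth //=; apply/existsP; exists d.
    by rewrite inE connect0 adj_sym.
  have nn u v : u \in A' -> v \in A' -> index u P < index v P ->
      ~~ G (nx u) (nx v).
    move=> /A'idx[u1 u2 uA uP'] /A'idx[v1 v2 vA vP] uv.
    apply: contra nocross => Guv.
    have uo : index u P < size P by flia.
    have vo : index v P < size P by flia.
    apply/existsP; exists (Ordinal uo); apply/existsP; exists (Ordinal vo) => /=.
    by rewrite uv v1 u2 v2 uA vA.
  move=> a b /setU1P[->|/imsetP[u uA' ->]] /setU1P[->|/imsetP[v vA' ->]].
  - by rewrite adj_irr.
  - exact: dnxn.
  - by rewrite adj_sym dnxn.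
  case: (ltngtP (index u P) (index v P)) => uv.
  - exact: nn.
  - by rewrite adj_sym nn.
  - by rewrite /nx uv adj_irr.
rewrite cardsU1 dnx card_in_imset //.
have := cardsD1 (last d P) A; rewrite -/A'; case: (_ \in A) => /=; flia.
Qed.

(** Lengthening the path y z as long as possible fills S. *)
Lemma ham_connected (S : {set T}) k y z :
    (forall K1 K2 : {set T}, K1 \subset S -> K2 \subset S -> separated K1 K2 ->
       #|K1| + #|K2| + k <= #|S|) ->
    (forall I : {set T}, I \subset S -> stable I -> #|I| < k) ->
    y \in S -> z \in S -> G y z ->
  exists P, [/\ uniq P, sorted G P, P =i S, head z P = y & last y P = z].
Proof.
move=> hsep hst yS zS Gyz.
suff loop n P : #|S| <= size P + n -> 1 < size P -> uniq P -> sorted G P ->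
    {subset P <= S} -> head z P = y -> last y P = z ->
    exists P, [/\ uniq P, sorted G P, P =i S, head z P = y & last y P = z].
  have yz : y != z by apply: contraTneq Gyz => ->; rewrite adj_irr.
  apply: (loop #|S| [:: y; z]); rewrite /= ?inE ?yz ?Gyz //; first by flia.
  by move=> v; rewrite !inE => /orP[]/eqP->.
elim: n P => [|n IH] P szP P1 uP sP PS hP lP.
all: case: (pickP [pred d in S | d \notin P]) => [d /andP[/= dS dP]|full];
  last by exists P; split=> // v; apply/idP/idP => [/PS//|vS];
    move: (full v); rewrite /= vS => /negbT; rewrite negbK.
  have : #|d |: [set x in P]| <= #|S|.
    apply: subset_leq_card; apply/subsetP => v /setU1P[-> //|].
    by rewrite inE => /PS.
  by rewrite cardsU1 inE dP /= cardsE (card_uniqP uP); flia.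
have [P' [uP' sP' P'S [hd la] szP']] := longer_path hsep hst P1 uP sP PS dS dP.
apply: (IH P') => //; try flia.
  by case: (P) (P') hP hd P1 szP' => [|a s] [|b t] //= -> ->.
by case: (P) (P') lP la P1 szP' => [|a s] [|b t] //= -> ->.
Qed.

(** * Longest paths from a given vertex *)

Definition path_in (X : {set T}) p s :=
  [&& uniq (p :: s), path G p s & all [in X] s].

Definition longest_in (X : {set T}) p s :=
  path_in X p s /\ forall s', path_in X p s' -> size s' <= size s.

Lemma ex_longest (X : {set T}) p : exists s, longest_in X p s.
Proof.
have exP : exists n, [exists t : n.-tuple T, path_in X p t].
  by exists 0; apply/existsP; exists [tuple].
have ub n : [exists t : n.-tuple T, path_in X p t] -> n <= #|T|.
  case/existsP => t /and3P[/= /andP[_ ut] _ _].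
  by rewrite -(size_tuple t) -(card_uniqP ut) max_card.
case: (ex_maxnP exP ub) => n /existsP[t pt] mx; exists t; split=> // s ps.
by rewrite size_tuple; apply: mx; apply/existsP; exists (in_tuple s).
Qed.

Lemma longest_nbr (X : {set T}) p s z :
  longest_in X p s -> z \in X -> z != p -> G (last p s) z -> z \in s.
Proof.
case=> /and3P[us ps sX] mx zX zp Gz; apply/negPn/negP => zs.
suff /mx : path_in X p (rcons s z) by rewrite size_rcons ltnn.
rewrite /path_in -rcons_cons rcons_uniq inE negb_or zp zs us rcons_path ps Gz.
by rewrite all_rcons zX sX.
Qed.

Lemma longest_perm (X : {set T}) p s s' :
  longest_in X p s -> path G p s' -> perm_eq s' s -> longest_in X p s'.
Proof.
move=> [/and3P[us ps sX] mx] ps' eq_s; split.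
  rewrite /path_in ps' (perm_all _ eq_s) sX /= (perm_mem eq_s).
  by rewrite (perm_uniq eq_s) andbT.
by move=> t; rewrite (perm_size eq_s); apply: mx.
Qed.

(** Posa rotation: if the last vertex of a longest path sees z, then reversing
    the part of the path after z gives a longest path with the same vertices
    that ends at the successor of z. *)
Lemma rotation_ends (X : {set T}) p s :
    p \notin X -> longest_in X p s -> s != [::] ->
  exists E : {set T}, #|[set z in p |: X | G (last p s) z]| <= #|E| /\
    forall u, u \in E -> u \in X /\
      exists s', [/\ longest_in X p s', s' != [::], perm_eq s' s & last p s' = u].
Proof.
move=> pX ls s0; have [/and3P[us ps sX] mx] := ls.
set f := last p s; set P := p :: s.
have fs : f \in s by rewrite /f; case: (s) s0 => //= a l _; apply: mem_last.
pose nx z := nth f P (index z P).+1.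
pose N := [set z in p |: X | G f z].
have Nidx z : z \in N -> [/\ (index z P).+1 < size P, nth f P (index z P) = z
    & G f z].
  rewrite !inE => /andP[zpX Gz]; have zP : z \in P.
    case: (eqVneq z p) zpX => [->|zp /= zX]; first by rewrite inE eqxx.
    by rewrite inE (longest_nbr ls) ?orbT.
  split=> //; last by rewrite nth_index.
  rewrite ltn_neqAle index_mem zP andbT; apply: contraTneq Gz => e.
  suff -> : z = f by rewrite adj_irr.
  by rewrite -(nth_index p zP) /f -[last p s]/(last p P) -nth_last -e.
exists (nx @: N); split.
  rewrite card_in_imset // => u v /Nidx[u1 u2 _] /Nidx[v1 v2 _] /eqP.
  by rewrite /nx nth_uniq // eqSS => /eqP e; rewrite -u2 -v2 e.
move=> u /imsetP[z /Nidx[z1 z2 Gz] ->]; set i := index z P in z1 z2 *.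
have i1 : i < size s by [].
have nxE : nx z = nth f s i by [].
split; first by rewrite nxE; apply: (allP sX); apply: mem_nth.
pose s' := take i s ++ rev (drop i s).
have eq_s : perm_eq s' s.
  by rewrite -[X in perm_eq _ X](cat_take_drop i s) perm_cat2l perm_rev.
have drop0 : rev (drop i s) != [::].
  by rewrite -size_eq0 size_rev size_drop; flia.
have ps' : path G p s'.
  suff : sorted G (take i.+1 P ++ rev (drop i.+1 P)) by [].
  have sP : sorted G P by [].
  apply: (sorted_join (x0 := f)); first exact: take_sorted.
    by rewrite rev_sortedG; apply: drop_sorted.
  by move=> _ _; rewrite last_take ?head_rev ?last_drop //= ?z2 1?adj_sym //; flia.
exists s'; split=> //.
- exact: longest_perm ls ps' eq_s.
- by rewrite -size_eq0 (perm_size eq_s) size_eq0.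
rewrite /s' last_cat nxE -[i in RHS]addn0 -nth_drop nth0 -last_rev.
by case: (rev _) drop0.
Qed.

Lemma sparse_count (a : pred T) s :
  sorted (fun x y => ~~ (a x && a y)) s -> 2 * count a s <= (size s).+1.
Proof.
have [n] := ubnP (size s); elim: n s => // n IH [|x [|y s]] //= sz.
  by move=> _; case: (a x).
case/andP => xy ys; have := IH s; have := IH (y :: s); rewrite /= ys.
have -> : sorted (fun x y => ~~ (a x && a y)) s.
  by move: ys; apply: path_sorted.
move=> /(_ _ isT) h1 /(_ _ isT) h2.
have {}h1 := h1 (ltac:(flia)); have {}h2 := h2 (ltac:(flia)).
by move: xy h1 h2; case: (a x); case: (a y) => //= _; flia.
Qed.

(** Let u be the last vertex of t. From p one can run through t to u, jump to a
    neighbour of u on s, and follow s in either direction; as p :: s is a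
    longest path, the neighbours of u on s are at least [size t] vertices away
    from both ends of s. No two of them are consecutive, for otherwise u could
    be inserted into s. If there is one at all, then u has at most
    (size s + 1) / 2 neighbours in X, counting those on t. *)
Lemma no_reentry (X : {set T}) m p s t :
    longest_in (X :\ p) p s -> longest_in (X :\: [set x in p :: s]) p t ->
    t != [::] -> m <= #|[set z in X | G (last p t) z]| ->
    size s + 3 <= 2 * m ->
  forall z, z \in s -> ~~ G (last p t) z.
Proof.
move=> ls lt t0 deg szs; have [/and3P[us ps sX] mxs] := ls.
have [/and3P[ut pt tR] mxt] := lt.
set u := last p t in deg *; move=> z0 z0s; apply/negP => Gz0.
have ut' : u \in t by rewrite /u; case: (t) t0 => //= a l _; apply: mem_last.
have [pns us'] : p \notin s /\ uniq s by case/andP: us.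
have [pnt ut''] : p \notin t /\ uniq t by case/andP: ut.
have ts x : x \in t -> x \notin s /\ x \in X :\ p.
  move/(allP tR); rewrite !inE negb_or => /andP[/andP[-> ->] ->] //.
have tX : all [in X :\ p] t by apply/allP => x /ts[].
have sub_new (l : seq T) : {subset l <= s} -> uniq l -> path G u l -> size t + size l <= size s.
  move=> ls' ul pl; rewrite -size_cat; apply: mxs; rewrite /path_in cat_path pt pl.
  rewrite /= mem_cat negb_or pnt cat_uniq ut'' ul all_cat tX /= !andbT.
  rewrite -andbA; apply/and3P; split.
  - by apply: contra pns => /ls'.
  - by apply/hasPn => x /ls' xs; apply/negP => /ts[]; rewrite xs.
  - by apply/allP => x /ls' /(allP sX).
have lo i : i < size s -> G u (nth u s i) -> size t <= i.
  move=> is_ Gi; have := sub_new (drop i s).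
  rewrite size_drop drop_uniq // (drop_nth u) //= Gi.
  move=> /(_ _ isT); rewrite -(drop_nth u) //.
  have -> : path G (nth u s i) (drop i.+1 s).
    have : sorted G (drop i s) by apply: drop_sorted; exact: path_sorted ps.
    by rewrite (drop_nth u).
  move=> /(_ (fun x h => mem_drop h) isT); flia.
have hi i : i < size s -> G u (nth u s i) -> size t + i < size s.
  move=> is_ Gi; have := sub_new (rev (take i.+1 s)).
  rewrite size_rev size_takel // rev_uniq take_uniq // addnS.
  apply=> // [x|]; first by rewrite mem_rev => /mem_take.
  have : sorted G (rev (take i.+1 s)).
    by rewrite rev_sortedG; apply: take_sorted; exact: path_sorted ps.
  have : head u (rev (take i.+1 s)) = nth u s i.
    by rewrite head_rev last_take.
  by case: (rev _) => //= a l ->; rewrite Gi.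
have sparse : sorted (fun x y => ~~ (G u x && G u y)) s.
  apply/(sortedP u) => i i1; apply/negP => /andP[G0 G1].
  have := mxs (take i.+1 s ++ u :: drop i.+1 s).
  rewrite size_cat /= addnS -size_cat cat_take_drop ltnn => h.
  suff : false by []. apply: h.
  have eqp : perm_eq (take i.+1 s ++ u :: drop i.+1 s) (u :: s).
    by rewrite -cat1s perm_catCA /= cat_take_drop.
  have [uns uX] := ts u ut'.
  have up : u != p by move: uX; rewrite !inE => /andP[].
  apply/and3P; split.
  - rewrite /= (perm_mem eqp) (perm_uniq eqp) /= inE negb_or eq_sym up pns uns.
    exact: us'.
  - have sP : sorted G (p :: s) by [].
    rewrite -[path _ _ _]/(sorted G ((p :: take i.+1 s) ++ [:: u] ++ drop i.+1 s)).
    apply: (sorted_join (x0 := u)).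
    + exact: (@take_sorted _ _ i.+2 (p :: s)).
    + apply: (sorted_join (x0 := u)) => //; last by rewrite head_drop.
      by apply: drop_sorted; exact: path_sorted ps.
    move=> _ _; rewrite -[last _ _]/(last p (take i.+1 s)) (last_nth u) /=.
    rewrite size_takel; last exact: ltnW.
    by rewrite -[nth u _ _]/(nth u (take i.+1 s) i) nth_take // adj_sym.
  - by rewrite (perm_all _ eqp) /= uX.
pose seg := drop (size t) (take (size s - size t) s).
have inseg z : z \in s -> G u z -> z \in seg.
  move=> zs Gz; have iz : index z s < size s by rewrite index_mem.
  have Giz : G u (nth u s (index z s)) by rewrite nth_index.
  have := lo _ iz Giz; have := hi _ iz Giz; set i := index z s => h1 h2.
  rewrite -(nth_index u zs) -/i -(subnKC h2) /seg.
  rewrite -(@nth_take (size s - size t)); last by rewrite subnKC //; flia.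
  rewrite -nth_drop; apply: mem_nth; rewrite size_drop size_takel ?leq_subr //.
  flia.
have szseg : size seg = size s - size t - size t.
  by rewrite size_drop size_takel ?leq_subr.
have seg1 : 0 < size seg by case: (seg) (inseg _ z0s Gz0).
have cseg : 2 * count (G u) seg <= (size seg).+1.
  by apply: sparse_count; apply/drop_sorted/take_sorted.
have : #|[set z in X | G u z]| <= size (p :: rem u t ++ filter (G u) seg).
  apply: leq_trans (card_size _); apply: subset_leq_card.
  apply/subsetP => z; rewrite !inE => /andP[zX Gz].
  case: eqVneq => //= zp; rewrite mem_cat mem_filter Gz /=.
  case: (boolP (z \in s)) => [zs|zns]; first by rewrite inseg ?orbT.
  have zt : z \in t.
    by apply: (longest_nbr lt) => //; rewrite !inE negb_or zp zns.
  by rewrite mem_rem_uniq // inE zt /= andbT; case: eqVneq Gz => // ->;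
    rewrite adj_irr.
rewrite /= size_cat size_rem // size_filter.
have : 0 < size t by rewrite lt0n size_eq0.
move: deg cseg seg1 szseg; move: (count _ _) #|_| (size seg) => a b c.
flia.
Qed.

(** Take a longest path from p. One of its many rotated ends is a neighbour of p,
    so its vertices form a cycle C. If C is too short then q lies on C: the
    rotated ends have no neighbour outside C, and q sees one of them. Now take a
    longest path from p among the vertices outside C. By [no_reentry] none of
    its rotated ends sees a vertex of C other than p, yet there are so many
    rotated ends that q sees one of them. *)
Lemma long_cycle (X : {set T}) m p q :
    p != q -> p \in X -> q \in X ->
    (forall w, w \in X -> m <= #|[set z in X | G w z]|) ->
    #|[set z in X | ~~ G p z]| <= m -> #|[set z in X | ~~ G q z]| <= m ->
    0 < m -> 3 * m <= #|X|.+1 ->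
  exists c, [/\ uniq c, cycle G c, {subset c <= X} & 2 * m <= (size c).+1].
Proof.
move=> pq pX qX deg missp missq m0 szX.
have nbr a (E : {set T}) : a \in X -> E \subset X -> a \notin E ->
    #|[set z in X | ~~ G a z]| <= m -> m <= #|E| -> exists2 w, w \in E & G a w.
  move=> aX EX aE miss szE; case: (pickP [pred w in E | G a w]).
    by move=> w /andP[]; exists w.
  move=> none; suff : #|a |: E| <= m by rewrite cardsU1 aE; flia.
  apply: leq_trans miss; apply: subset_leq_card; apply/subsetP => z.
  case/setU1P => [->|zE]; first by rewrite inE aX adj_irr.
  rewrite inE (subsetP EX) //=; apply/negP => Gz.
  by move: (none z); rewrite /= zE Gz.
have [s ls] := ex_longest (X :\ p) p; have [/and3P[us ps sX] mxs] := ls.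
have ins z : z \in s -> z \in X /\ z != p.
  by move/(allP sX); rewrite !inE => /andP[].
have s0 : s != [::].
  have /card_gt0P[z] : 0 < #|[set z in X | G p z]| by apply: leq_trans (deg p pX).
  rewrite inE => /andP[zX Gz]; rewrite -size_eq0 -lt0n.
  have pz : p != z by apply: contraTneq Gz => ->; rewrite adj_irr.
  by apply: (mxs [:: z]); rewrite /path_in /= !inE pz Gz eq_sym pz zX.
have lastX t : {subset t <= X} -> last p t \in X.
  by case: t => //= a t h; apply/h/mem_last.
have XpE : p |: X :\ p = X by rewrite setD1K.
have fullE a : [set z in p |: X :\ p | G a z] = [set z in X | G a z].
  by rewrite XpE.
have [|E1 [szE1 hE1]] := rotation_ends _ ls s0; first by rewrite setD11.
rewrite fullE in szE1.
have lX : last p s \in X by apply: lastX => z /ins[].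
have {}szE1 := leq_trans (deg _ lX) szE1.
have E1X : E1 \subset X.
  by apply/subsetP => z /hE1[]; rewrite !inE => /andP[].
have pE1 : p \notin E1 by apply/negP => /hE1[]; rewrite setD11.
have [w wE1 Gpw] := nbr p E1 pX E1X pE1 missp szE1.
have [_ [s' [ls' _ eq_s' lw]]] := hE1 w wE1.
have [/and3P[us' ps' sX'] _] := ls'.
case: (leqP (2 * m) (size s').+2) => szs.
  exists (p :: s'); split=> //.
    by rewrite (sorted_cycle (x0 := p)) //= lw adj_sym.
  by move=> z; rewrite inE => /orP[/eqP-> //|/(allP sX')]; rewrite !inE => /andP[].
have {}szs : size s + 3 <= 2 * m by rewrite -(perm_size eq_s'); flia.
pose R := X :\: [set x in p :: s].
have RX : R \subset X by apply: subsetDl.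
have E1R u z : u \in E1 -> z \in R -> ~~ G u z.
  move=> uE1 zR; have [_ [s1 [ls1 _ eq_s1 lu]]] := hE1 u uE1; apply/negP => Gu.
  have := zR; rewrite !inE negb_or => /andP[/andP[zp zs] zX].
  suff : z \in s1 by rewrite (perm_mem eq_s1) (negbTE zs).
  by apply: (longest_nbr ls1) => //; rewrite ?lu // !inE zp.
have qs : q \in s.
  apply/negPn/negP => qs.
  have qR : q \in R by rewrite !inE negb_or eq_sym pq qs.
  have qE1 : q \notin E1.
    apply/negP => /hE1[_ [s1 [[/and3P[_ _ s1X] _] s10 eq_s1 lq]]].
    case/negP: qs; rewrite -(perm_mem eq_s1) -lq.
    by case: (s1) s10 => //= a l _; apply: mem_last.
  have [u uE1] := nbr q E1 qX E1X qE1 missq szE1.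
  by rewrite adj_sym; apply/negP/E1R.
have szR : m <= #|R|.
  have : #|X| - #|[set x in p :: s]| <= #|R|.
    by rewrite cardsD leq_sub2l // subset_leq_card // subsetIr.
  by rewrite cardsE (card_uniqP us) /=; flia.
have pR : p \notin R by rewrite !inE eqxx.
have [r rR Gpr] := nbr p R pX RX pR missp szR.
have [t lt] := ex_longest R p; have [/and3P[ut pt tR] mxt] := lt.
have t0 : t != [::].
  rewrite -size_eq0 -lt0n; apply: (mxt [:: r]); rewrite /path_in /= !inE Gpr.
  move: rR; rewrite !inE negb_or => /andP[/andP[rp rs] rX].
  by rewrite eq_sym rp rX rs.
have [E2 [szE2 hE2]] := rotation_ends pR lt t0.
have noent t1 : longest_in R p t1 -> t1 != [::] -> last p t1 \in X ->
    forall z, z \in s -> ~~ G (last p t1) z.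
  by move=> lt1 t10 l1X; apply: no_reentry ls lt1 t10 (deg _ l1X) szs.
have ltX : last p t \in X.
  by apply: lastX => z /(allP tR)/(subsetP RX).
have {}szE2 : m <= #|E2|.
  apply: leq_trans (deg _ ltX) (leq_trans _ szE2); apply: subset_leq_card.
  apply/subsetP => z; rewrite !inE => /andP[zX Gz]; rewrite zX Gz !andbT.
  case: eqVneq => //= zp; apply/negP => zs.
  by have := noent t lt t0 ltX z zs; rewrite Gz.
have E2R : E2 \subset R by apply/subsetP => z /hE2[].
have qE2 : q \notin E2.
  by apply/negP => /(subsetP E2R); rewrite !inE qs orbT.
have [u uE2 Gqu] := nbr q E2 qX (subset_trans E2R RX) qE2 missq szE2.
have [uR [t1 [lt1 t10 _ lu]]] := hE2 u uE2.
have := noent t1 lt1 t10; rewrite lu => /(_ (subsetP RX _ uR) q qs).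
by rewrite adj_sym Gqu.
Qed.

(** * Alternating cycles *)

Lemma next_split p x q :
  uniq (p ++ x :: q) -> next (p ++ x :: q) x = head x (q ++ p).
Proof.
move=> u; rewrite -(next_rot (size p) u) rot_size_cat /=.
by case: (q ++ p) => [|y l] /=; rewrite eqxx.
Qed.

Section Alternating.
Variables (A B : {set T}) (m : nat).
Hypotheses (disAB : [disjoint A & B]) (stA : stable A).
Hypotheses (szA : #|A| <= m) (szB : 2 * m <= #|B|).
Hypothesis missB : forall a, a \in A -> #|[set b in B | ~~ G a b]| < m.

(** As A is independent, a cycle half of whose vertices are in A does alternate
    between A and B ([alternating_next]). A single edge, seen as a cycle with two
    vertices, is allowed: it is where [alternating_cycle] starts. *)
Definition alternating c :=
  [/\ uniq c, cycle G c, {subset c <= A :|: B}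
    & size c = 2 * #|[set x in c | x \in A]|].

Let notAB x : x \in A -> x \notin B.
Proof. by move=> xA; rewrite (disjointFr disAB). Qed.

Let notBA x : x \in B -> x \notin A.
Proof. by move=> xB; rewrite (disjointFl disAB). Qed.

Lemma alternating_size c : alternating c ->
  #|[set x in c | x \in B]| = #|[set x in c | x \in A]|.
Proof.
case=> uc _ cAB szc.
have : #|[set x in c]| = size c by rewrite cardsE (card_uniqP uc).
rewrite (_ : [set x in c] = [set x in c | x \in A] :|: [set x in c | x \in B]).
  rewrite cardsU szc (_ : _ :&: _ = set0) ?cards0; first by flia.
  apply/setP => x; rewrite !inE; apply/negP.
  by case/andP => /andP[_ /notAB/negbTE->]; rewrite andbF.
apply/setP => x; rewrite !inE -andb_orr; case: (boolP (x \in c)) => //= /cAB.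
by rewrite inE.
Qed.

(** The successor function maps the vertices of c in A injectively into those in
    B; the two sets have the same size, so no successor of a vertex in B is left
    in B. *)
Lemma alternating_next c b :
  alternating c -> b \in c -> b \in B -> next c b \in A.
Proof.
move=> alt bc bB; have eqAB := alternating_size alt.
have [uc cc cAB szc] := alt; set Ac := [set x in c | x \in A] in eqAB.
set Bc := [set x in c | x \in B] in eqAB.
have inj : injective (next c) := can_inj (prev_next uc).
have sub : next c @: Ac \subset Bc.
  apply/subsetP => y /imsetP[x]; rewrite inE => /andP[xc xA] ->.
  have nc : next c x \in c by rewrite mem_next.
  rewrite inE nc /=; have := cAB _ nc; rewrite inE => /orP[nA|//].
  by have := next_cycle cc xc; rewrite (negbTE (stA xA nA)).
have eqB : next c @: Ac = Bc.
  by apply/eqP; rewrite eqEcard sub card_imset // eqAB /=.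
have nc : next c b \in c by rewrite mem_next.
have := cAB _ nc; rewrite inE => /orP[//|nB].
have : next c b \in Bc by rewrite inE nc.
rewrite -eqB => /imsetP[x]; rewrite inE => /andP[_ xA] /inj e.
by move: xA; rewrite -e (negbTE (notBA bB)).
Qed.

Lemma alternating_grow c c' a :
    alternating c -> a \in A -> a \notin c -> uniq c' -> cycle G c' ->
    {subset c' <= A :|: B} ->
    {in A, forall x, (x \in c') = (x == a) || (x \in c)} ->
    size c' = (size c).+2 ->
  alternating c' /\ #|[set x in c' | x \in A]| = #|[set x in c | x \in A]|.+1.
Proof.
move=> [uc cc cAB szc] aA ac uc' cc' c'AB memc' szc'.
have eA : [set x in c' | x \in A] = a |: [set x in c | x \in A].
  apply/setP => x; rewrite !inE; case: (boolP (x \in A)) => xA.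
    by rewrite memc' ?andbT.
  by rewrite !andbF orbF; apply/esym/negbTE; apply: contraNneq xA => ->.
have szAc' : #|[set x in c' | x \in A]| = #|[set x in c | x \in A]|.+1.
  by rewrite eA cardsU1 inE (negbTE ac).
by split=> //; split=> //; rewrite szc' szAc' szc; flia.
Qed.

(** Let k be the number of vertices of c in A, and U the set of vertices of B off
    c. If a sees b on c, then a and the successor of b have no common neighbour
    in U, otherwise both could be inserted after b; and if a sees b1 and b2,
    their successors have no common neighbour in U, by crossing over. So every
    vertex of U is missed by all but one of a and these successors, which is
    more than the bound on missed vertices allows. If a sees no vertex of c in
    B, it misses k vertices there and fewer than m - k in U, so it shares two
    neighbours in U with each vertex of A: any vertex b0 of c in B can be replaced
    by a flanked by two vertices of U. *)
Lemma alternating_extend c a :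
    alternating c -> c != [::] -> a \in A -> a \notin c ->
  exists c', [/\ alternating c', c' != [::] &
    #|[set x in c' | x \in A]| = #|[set x in c | x \in A]|.+1].
Proof.
move=> alt c0 aA ac; have [uc cc cAB szc] := alt.
have eqAB := alternating_size alt; have nextA := alternating_next alt.
set k := #|[set x in c | x \in A]| in szc eqAB *.
set Bc := [set x in c | x \in B] in eqAB.
have k0 : 0 < k by move: c0; rewrite -size_eq0 szc; flia.
pose U := B :\: Bc.
have BcB : Bc \subset B by apply/subsetP => x; rewrite inE => /andP[].
have szU : #|U| = #|B| - k by rewrite cardsDS // eqAB.
have szkB : k <= #|B| by rewrite -eqAB subset_leq_card.
have inU b : b \in U -> b \in B /\ b \notin c.
  by rewrite !inE => /andP[+ bB]; rewrite bB andbT.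
have aB := notAB aA.
have missU x : x \in A -> #|U| < #|[set b in U | G x b]| + m.
  move=> xA; have : #|[set b in U | ~~ G x b]| < m.
    apply: leq_ltn_trans (missB xA); apply: subset_leq_card.
    apply/subsetP => b; rewrite !inE.
    by move=> /andP[/andP[_ ->] ->].
  have -> : [set b in U | ~~ G x b] = U :\: [set b in U | G x b].
    by apply/setP => b; rewrite !inE; case: (b \in B); case: (G x b);
      rewrite ?andbF ?andbT //=; case: (b \in c).
  rewrite cardsDS; first by flia.
  by apply/subsetP => b; rewrite inE => /andP[].
have grow c' : uniq c' -> cycle G c' -> {subset c' <= A :|: B} ->
    {in A, forall x, (x \in c') = (x == a) || (x \in c)} ->
    size c' = (size c).+2 ->
    exists c', [/\ alternating c', c' != [::] & #|[set x in c' | x \in A]| = k.+1].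
  move=> uc' cc' c'AB memc' szc'.
  have [alt' eqk] := alternating_grow alt aA ac uc' cc' c'AB memc' szc'.
  by exists c'; split=> //; rewrite -size_eq0 szc'.
have rotB b : b \in Bc -> exists p, [/\ uniq (b :: p), cycle G (b :: p),
    b :: p =i c, size (b :: p) = size c & next c =1 next (b :: p)].
  rewrite inE => /andP[bc bB]; have [i p ep] := rot_to bc; exists p.
  rewrite -ep rot_uniq rot_cycle size_rot; split=> // [x|x].
    exact: mem_rot.
  by rewrite next_rot.
have headA b p : b \in Bc -> uniq (b :: p) -> next c =1 next (b :: p) ->
    next c b = head b p /\ p != [::].
  rewrite inE => /andP[bc bB] up nx.
  have nb : next c b = head b p by rewrite nx (@next_split [::]) // cats0.
  split=> //; apply/eqP => p0; have := nextA b bc bB; rewrite nb p0 /=.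
  by rewrite (negbTE (notBA bB)).
pose S := [set b in Bc | G a b].
have inS b : b \in S -> [/\ b \in Bc, b \in c, b \in B & G a b].
  by rewrite !inE => /andP[/andP[-> ->] ->].
have insert b u : b \in S -> u \in U -> G a u -> G (next c b) u ->
    exists c', [/\ alternating c', c' != [::] & #|[set x in c' | x \in A]| = k.+1].
  move=> /inS[bBc bc bB Gab] /inU[uB uc'] Gau; have [p [up cp memp szp nx]] := rotB b bBc.
  have [-> p0] := headA b p bBc up nx.
  case: p p0 up cp memp szp {nx} => // y p _ up cp memp szp /= Gyu.
  apply: (grow [:: b, a, u, y & p]).
  - have -> : uniq [:: b, a, u, y & p] = uniq [:: a, u, b, y & p].
      by apply: perm_uniq; rewrite -(perm_catCA [:: a; u] [:: b]).
    rewrite cons_uniq cons_uniq up inE !memp negb_or ac uc' !andbT.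
    by apply: contraNneq aB => ->.
  - move: cp; rewrite /= => /andP[_ ->]; rewrite adj_sym Gab Gau adj_sym Gyu //.
  - move=> x; rewrite !inE => /or4P[/eqP->|/eqP->|/eqP->|h].
    + by rewrite bB orbT.
    + by rewrite aA.
    + by rewrite uB orbT.
    + by have /cAB : x \in c by [rewrite -memp !inE h orbT]; rewrite inE.
  - move=> x xA; rewrite -memp !inE; have xu : x != u.
      by apply: contraTneq xA => ->; apply: notBA.
    rewrite (negbTE xu) /=; by case: (x == b); case: (x == a).
  - by rewrite -szp.
have cross b1 b2 u : b1 \in S -> b2 \in S -> b1 != b2 -> u \in U ->
    G (next c b1) u -> G (next c b2) u ->
    exists c', [/\ alternating c', c' != [::] & #|[set x in c' | x \in A]| = k.+1].
  move=> /inS[b1Bc b1c b1B Gab1] /inS[b2Bc b2c b2B Gab2] b12 /inU[uB uc'].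
  have n1A := nextA _ b1c b1B; have n2A := nextA _ b2c b2B.
  have [p [up cp memp szp nx]] := rotB b1 b1Bc.
  have [n1 _] := headA b1 p b1Bc up nx.
  have b2p : b2 \in p.
    by have := memp b2; rewrite b2c inE eq_sym (negbTE b12).
  case/splitPr: p / b2p up cp memp szp nx n1 => p1 p2 up cp memp szp nx n1.
  have n2 : next c b2 = head b2 (p2 ++ b1 :: p1).
    by rewrite nx -cat_cons next_split.
  have {n1} n1 : next c b1 = head b1 p1 /\ p1 != [::].
    case: p1 n1 {up cp memp szp nx n2} => //= n1.
    by move: n1A; rewrite n1 (negbTE (notBA b2B)).
  have {n2} n2 : next c b2 = head b2 p2 /\ p2 != [::].
    case: p2 n2 {up cp memp szp nx} => //= n2.
    by move: n2A; rewrite n2 (negbTE (notBA b1B)).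
  case: n1 n2 => -> p10 [-> p20] Gu1 Gu2.
  pose c' := [:: b1, a, b2 & rev p1 ++ u :: p2].
  have eqc' : perm_eq c' ([:: a; u] ++ b1 :: p1 ++ b2 :: p2).
    apply/permP => P; rewrite /c' /= !count_cat /= count_rev.
    move: (count P p1) (count P p2) => n1 n2; flia.
  have cpath : [/\ sorted G p1, G (last b1 p1) b2, path G b2 p2
      & G (last b2 p2) b1].
    move: cp; rewrite /= rcons_path cat_path /= last_cat /=.
    by case/andP=> /and3P[/path_sorted].
  have [sp1 l1 pp2 l2] := cpath.
  apply: (grow c').
  - rewrite (perm_uniq eqc'); move: up memp; set l := b1 :: _ => up memp.
    rewrite /= inE negb_or !memp ac uc'; move: up => /= /andP[-> ->].
    by rewrite !andbT; apply: contraNneq aB => ->.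
  - apply: (sorted_cycle (x0 := u)); last first.
      by rewrite /= last_cat /=; case: (p2) p20 l2 => // *.
    rewrite -[c']/([:: b1; a; b2] ++ rev p1 ++ u :: p2).
    apply: (sorted_join (x0 := u)).
    + by rewrite /= adj_sym Gab1 Gab2.
    + apply: (sorted_join (x0 := u)); first by rewrite rev_sortedG.
        case: (p2) p20 pp2 Gu2 => //= y l _ /andP[_ ->].
        by rewrite adj_sym => ->.
      by move=> _ _ /=; rewrite last_rev; case: (p1) p10 Gu1.
    move=> _ _ /=; rewrite -nth0 nth_cat size_rev lt0n size_eq0 p10 nth0.
    by rewrite head_rev adj_sym; case: (p1) p10 l1.
  - move=> x; rewrite (perm_mem eqc') mem_cat memp => /orP[|/cAB]; rewrite !inE.
      by case/orP=> /eqP->; rewrite ?aA ?uB ?orbT.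
    by [].
  - move=> x xA; rewrite (perm_mem eqc') mem_cat memp !inE -orbA; congr orb.
    have -> : x == u = false by apply: contraTF xA => /eqP->; apply: notBA.
    by [].
  - by rewrite (perm_size eqc') size_cat szp.
case: (set_0Vmem S) => [S0|[b0 b0S]]; last first.
  pose Z := a |: next c @: S.
  have nxinj : injective (next c) := can_inj (prev_next uc).
  have aZ : a \notin next c @: S.
    by apply: contra ac => /imsetP[b /inS[_ bc _ _] ->]; rewrite mem_next.
  case: (pickP [pred u in U | 1 < #|[set z in Z | G z u]|]) => [u|none].
    case/andP => uU /card_gt1P[x [y [xZ yZ xy]]].
    move: xZ yZ; rewrite !inE => /andP[xZ Gx] /andP[yZ Gy].
    case/orP: xZ Gx xy => [/eqP->|/imsetP[b1 b1S ->]] Gx xy.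
      case/orP: yZ Gy xy => [/eqP->|/imsetP[b2 b2S ->]] Gy; rewrite ?eqxx // => _.
      exact: (insert b2 u).
    case/orP: yZ Gy xy => [/eqP->|/imsetP[b2 b2S ->]] Gy xy.
      exact: (insert b1 u).
    apply: (cross b1 b2 u) => //; by apply: contra_neq xy => ->.
  exfalso; have : \sum_(z in Z) #|[set u in U | G z u]| <= #|U|.
    rewrite (eq_bigr (fun z => \sum_(u in U) G z u)); last first.
      move=> z _; rewrite -sum1dep_card big_mkcondr /=; apply: eq_bigr => u _.
      by case: (G z u).
    rewrite exchange_big /= -sum1_card; apply: leq_sum => u uU.
    have := none u; rewrite /= uU /= => /negbT; rewrite -leqNgt.
    suff -> : \sum_(z in Z) G z u = #|[set z in Z | G z u]| by [].
    rewrite -sum1dep_card big_mkcondr /=.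
    by apply: eq_bigr => z _; case: (G z u).
  rewrite big_setU1 //= big_imset /=; last by move=> x y _ _; apply: nxinj.
  have : #|S| * (#|U|.+1 - m) <= \sum_(b in S) #|[set u in U | G (next c b) u]|.
    rewrite -sum_nat_const; apply: leq_sum => b /inS[_ bc bB _].
    by have := missU _ (nextA _ bc bB); flia.
  have : #|U| + (k - #|S|) < #|[set u in U | G a u]| + m.
    have := missB aA.
    have -> : [set b in B | ~~ G a b] =
        (U :\: [set u in U | G a u]) :|: (Bc :\: S).
      apply/setP => b; rewrite !inE; case: (b \in B); case: (b \in c);
        by case: (G a b).
    rewrite cardsU (_ : _ :&: _ = set0); last first.
      by apply/setP => b; rewrite !inE; case: (b \in B); case: (b \in c);
        case: (G a b).
    have subU : [set u in U | G a u] \subset U.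
      by apply/subsetP => b; rewrite inE => /andP[].
    have subS : S \subset Bc by apply/subsetP => b; rewrite inE => /andP[].
    rewrite cards0 subn0 (cardsDS subU) (cardsDS subS) eqAB.
    by have := subset_leq_card subU; flia.
  have : #|S| <= k.
    by rewrite -eqAB; apply/subset_leq_card/subsetP => b /inS[].
  have : 0 < #|S| by apply/card_gt0P; exists b0.
  have km : k < m.
    apply: leq_trans szA; apply: proper_card; apply/properP; split.
      by apply/subsetP => x; rewrite inE => /andP[].
    by exists a; rewrite // inE (negbTE ac).
  have lbU : 2 * m - k <= #|U| by rewrite szU leq_sub2r.
  have arith w u n g i j : i < j -> 0 < w -> w <= i -> u + (i - w) < n + j ->
      w * (u.+1 - j) <= g -> n + g <= u -> 2 * j - i <= u -> False.
    clear; nia.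
  by move=> s1 s2 s3 s4 s5; apply: arith km s1 s2 s3 s4 s5 lbU.
have {}S0 b : b \in Bc -> ~~ G a b.
  by move=> bB; apply/negP => Gab; have := in_set0 b; rewrite -S0 inE bB Gab.
have [b0 b0B] : exists b0, b0 \in Bc by apply/card_gt0P; rewrite eqAB.
have [p [up cp memp szp nx]] := rotB b0 b0B.
have [hp p0] := headA b0 p b0B up nx.
have b0cB : b0 \in c /\ b0 \in B by apply/andP; move: b0B; rewrite inE.
have hA : head b0 p \in A by rewrite -hp nextA; case: b0cB.
have lp : last b0 p \in p by case: (p) p0 => //= y l _; apply: mem_last.
have lc : last b0 p \in c by rewrite -memp inE lp orbT.
have lA : last b0 p \in A.
  have := cAB _ lc; rewrite inE => /orP[//|lB].
  have := nextA _ lc lB; rewrite nx.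
  have -> : next (b0 :: p) (last b0 p) = b0.
    move: (p) p0 up; case/lastP => // p' y _ up; rewrite last_rcons.
    by move: up; rewrite -cats1 -cat_cons => up; rewrite next_split.
  by rewrite (negbTE (notBA b0cB.2)).
have km : #|[set u in U | ~~ G a u]| + k < m.
  apply: leq_trans (missB aA); rewrite ltnS -eqAB -cardsUI.
  rewrite (_ : _ :&: Bc = set0) ?cards0 ?addn0.
    apply: subset_leq_card; apply/subsetP => u; rewrite in_setU => /orP[|uB].
      by rewrite !inE => /andP[/andP[_ ->] ->].
    by rewrite inE S0 // andbT; apply: subsetP BcB _ uB.
  apply/setP => u; rewrite in_setI in_set in_setD in_set0.
  by case: (u \in Bc); rewrite ?andbF.
have common x : x \in A -> 1 < #|[set u in U | G a u && G x u]|.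
  move=> xA; have := missU x xA.
  have : #|[set u in U | G x u]| <=
      #|[set u in U | ~~ G a u]| + #|[set u in U | G a u && G x u]|.
    apply: leq_trans (leq_card_setU _ _); apply: subset_leq_card.
    apply/subsetP => u; rewrite !inE => /andP[-> ->]; rewrite andbT /=.
    by case: (G a u).
  have lbU : 2 * m - k <= #|U| by rewrite szU leq_sub2r.
  by flia.
have [u [uU Gau Glu]] : exists u, [/\ u \in U, G a u & G (last b0 p) u].
  have /card_gt0P[u] := ltnW (common _ lA).
  by rewrite inE => /andP[uU /andP[? ?]]; exists u.
have [v [vU Gav Ghv vu]] : exists v, [/\ v \in U, G a v, G (head b0 p) v & v != u].
  have /card_gt1P[v1 [v2 []]] := common _ hA.
  rewrite !inE => /andP[/andP[v1c v1B] /andP[Ga1 Gh1]].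
  case/andP=> /andP[v2c v2B] /andP[Ga2 Gh2] v12.
  case: (eqVneq v1 u) => [e|ne]; last by exists v1; rewrite !inE v1c v1B.
  by exists v2; rewrite !inE v2c v2B; split=> //; rewrite -e eq_sym.
have [uB uc'] := inU u uU; have [vB vc'] := inU v vU.
have pc x : x \in p -> x \in c by move=> xp; rewrite -memp inE xp orbT.
have notp x : x \notin c -> x \notin p by apply: contra => /pc.
apply: (grow [:: u, a, v & p]).
- rewrite /= !inE !negb_or (notp _ ac) (notp _ uc') (notp _ vc').
  have /andP[_ ->] : (b0 \notin p) && uniq p by [].
  rewrite (eq_sym u v) vu !andbT.
  by apply/andP; split; [apply: contraNneq aB => <- | apply: contraNneq aB => ->].
- apply: (sorted_cycle (x0 := b0)); last first.
    by rewrite /=; case: (p) p0 Glu.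
  move: cp; rewrite /= rcons_path => /andP[pp _]; rewrite adj_sym Gau Gav /=.
  by case: (p) p0 pp Ghv => //= y l _ /andP[_ ->]; rewrite adj_sym => ->.
- move=> x; rewrite !inE => /or4P[/eqP->|/eqP->|/eqP->|/pc /cAB].
  + by rewrite uB orbT.
  + by rewrite aA.
  + by rewrite vB orbT.
  by rewrite inE.
- move=> x xA; rewrite -memp !inE.
  have ne y : y \in B -> x == y = false.
    by move=> yB; apply: contraTF xA => /eqP->; apply: notBA.
  by rewrite (ne u) // (ne v) // (ne b0 b0cB.2).
- by rewrite -szp.
Qed.

Lemma alternating_cycle :
  0 < #|A| -> exists c, [/\ uniq c, cycle G c, {subset c <= A :|: B}
    & size c = 2 * #|A|].
Proof.
move=> A0.
suff [c [alt _ szc]] : exists c, [/\ alternating c, c != [::]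
    & #|[set x in c | x \in A]| = #|A|].
  by exists c; case: alt => uc cc sub ->; rewrite szc.
suff loop n : 0 < n <= #|A| -> exists c, [/\ alternating c, c != [::]
    & #|[set x in c | x \in A]| = n] by apply: loop; rewrite A0 leqnn.
elim: n => // n IH /andP[_ nA]; case: (posnP n) => [->|n0].
  have /card_gt0P[a aA] := A0.
  have [b bB Gab] : exists2 b, b \in B & G a b.
    case: (pickP [pred b in B | G a b]) => [b /andP[]|none]; first by exists b.
    have := missB aA; have -> : [set b in B | ~~ G a b] = B.
      apply/setP => b; rewrite inE; case: (boolP (b \in B)) => //= bB.
      by have := none b; rewrite /= bB => /= ->.
    by move: szA szB A0; move: #|A| #|B| => x1 x2; flia.
  have szAc : [set x in [:: b; a] | x \in A] = [set a].
    apply/setP => x; rewrite !inE; case: (eqVneq x b) => [->|xb] /=.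
      by rewrite (negbTE (notBA bB)); apply/esym/negbTE;
        apply: contraNneq (notBA bB) => ->.
    by case: eqVneq => // ->; rewrite aA.
  exists [:: b; a]; rewrite szAc cards1; split=> //.
  rewrite /alternating szAc cards1 /= inE Gab adj_sym Gab !andbT; split=> //.
    by apply: contraTneq bB => ->; apply: notAB.
  by move=> x; rewrite !inE => /orP[]/eqP->; rewrite ?aA ?bB ?orbT.
have [|c [alt c0 szc]] := IH; first by rewrite n0 ltnW.
have [a aA ac] : exists2 a, a \in A & a \notin c.
  case: (pickP [pred a in A | a \notin c]) => [a /andP[]|none]; first by exists a.
  move: nA; rewrite -szc ltnNge; case/negP; apply: subset_leq_card.
  apply/subsetP => a aA; rewrite inE aA andbT; have := none a.
  by rewrite /= aA /= => /negbT; rewrite negbK.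
by have := alternating_extend alt c0 aA ac; rewrite szc.
Qed.

End Alternating.

End Paths.

(** * Graphs without wheels *)

Section Wheels.
Variables (T : finType) (G : sgraph T).
Implicit Types (x y : T) (s c : seq T).
Local Notation stable := (@stable T G).
Local Notation separated := (@separated T G).

Lemma separated_sym K1 K2 : separated K1 K2 -> separated K2 K1.
Proof.
case=> K10 K20 dis nadj; split; rewrite // 1?disjoint_sym // => x y xK yK.
by rewrite adj_sym nadj.
Qed.

Lemma exists_subset (S : {set T}) n : n <= #|S| ->
  exists2 A : {set T}, A \subset S & #|A| = n.
Proof.
move=> nS; exists [set x in take n (enum S)].
  by apply/subsetP => x; rewrite inE => /mem_take; rewrite mem_enum.
rewrite cardsE (card_uniqP _) ?size_takel -?cardE //.
exact: take_uniq (enum_uniq _).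
Qed.

Definition nbh x := [set y | G x y].

Section WheelFree.
Variable m : nat.
Hypotheses (m3 : 2 < m) (szT : #|T|.+1 = 5 * m).
Hypothesis missG : forall v, #|[set w | ~~ G v w]| < 2 * m.
Hypothesis no_wheel : forall v c,
  uniq c -> cycle G c -> size c = 2 * m -> ~ {subset c <= nbh v}.

Lemma nbhC v : [set w | ~~ G v w] = ~: nbh v.
Proof. by apply/setP => w; rewrite !inE. Qed.

Lemma nbh_size v : 3 * m <= #|nbh v|.
Proof. by have := cardsC (nbh v); have := missG v; rewrite nbhC; flia. Qed.

Lemma degree_in (S : {set T}) w : #|S| < #|[set z in S | G w z]| + 2 * m.
Proof.
rewrite -(setID S (nbh w)); apply: leq_ltn_trans (leq_card_setU _ _) _.
rewrite -addnS; apply: leq_add.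
  by apply: subset_leq_card; apply/subsetP => z; rewrite !inE => /andP[-> ->].
apply: leq_ltn_trans (missG w); apply: subset_leq_card.
by apply/subsetP => z; rewrite !inE => /andP[->].
Qed.

Lemma few_nbrs_on_cycle v c x :
    uniq c -> cycle G c -> {subset x :: c <= nbh v} -> x \notin c ->
  2 * m <= (size c).+1 -> 2 * count (G x) c <= size c.
Proof.
move=> uc cc sub xc szc; rewrite leqNgt; apply/negP => lt_c.
have [|s [us cs szs subs]] := @cycle_arc _ G c x (2 * m).-1 uc cc xc lt_c.
  by flia.
apply: (@no_wheel v s) => //; first by rewrite szs; flia.
by move=> z /subs /sub.
Qed.

(** m elements of I and the rest of N(v) meet the conditions of
    [alternating_cycle]: each of the m vertices already misses the m - 1 others,
    so it misses at most m - 1 vertices of the rest. *)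
Lemma stable_nbh v (I : {set T}) : I \subset nbh v -> stable I -> #|I| < m.
Proof.
move=> Iv stI; rewrite ltnNge; apply/negP => /exists_subset[A AI szA].
have stA : stable A by move=> x y /(subsetP AI) xI /(subsetP AI); apply: stI.
have Av := subset_trans AI Iv.
have [|||||c [uc cc cAB szc]] := @alternating_cycle _ G A (nbh v :\: A) m _ stA.
- by rewrite -setI_eq0; apply/eqP/setP => z; rewrite !inE; case: (z \in A).
- by rewrite szA.
- by rewrite cardsDS // szA; have := nbh_size v; flia.
- move=> a aA; have := missG a; rewrite mul2n -addnn -{1}szA.
  have sub : A :|: [set b in nbh v :\: A | ~~ G a b] \subset [set w | ~~ G a w].
    apply/subsetP => z; rewrite !inE => /orP[zA|/andP[]//]; exact: stA.
  have := subset_leq_card sub; rewrite cardsU (_ : _ :&: _ = set0) ?cards0.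
    by rewrite szA; flia.
  by apply/setP => z; rewrite !inE; case: (z \in A).
- by rewrite szA; flia.
apply: (@no_wheel v c uc cc); first by rewrite szc szA.
by move=> z /cAB; rewrite in_setU in_setD => /orP[/(subsetP Av)|/andP[]].
Qed.

(** Both u and any p in K1 miss all of K2, which uses up most of their
    non-neighbours: u sees many vertices of K1, and if it sees p then p sees
    most of N(u). *)
Lemma separated_nbh K1 K2 u :
    separated K1 K2 -> u \in K1 ->
  #|K1| + #|K2| < #|nbh u :&: K1| + 2 * m /\
  {in nbh u :&: K1, forall p, #|[set z in nbh u | ~~ G p z]| + #|K2| < 2 * m}.
Proof.
move=> [_ _ dis nadj] uK; split.
  have := missG u; have := cardsID (nbh u) K1; rewrite setIC => <-.
  have sub : (K1 :\: nbh u) :|: K2 \subset [set w | ~~ G u w].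
    apply/subsetP => z; rewrite !inE => /orP[/andP[]//|]; exact: nadj.
  have := subset_leq_card sub; rewrite cardsU (_ : _ :&: _ = set0) ?cards0.
    by flia.
  apply/setP => z; rewrite !inE; case: (boolP (z \in K1)) => zK; rewrite ?andbF //.
  by rewrite (disjointFr dis zK) andbF.
move=> p; rewrite inE => /andP[_ pK]; apply: leq_ltn_trans (missG p).
rewrite -cardsUI (_ : _ :&: _ = set0) ?cards0 ?addn0.
  apply: subset_leq_card; apply/subsetP => z.
  rewrite !inE => /orP[/andP[]//|]; exact: nadj.
apply/setP => z; rewrite !inE; apply/negP => /andP[/andP[Guz _] zK].
by have := nadj _ _ uK zK; rewrite Guz.
Qed.

(** Otherwise some u in K1 has three neighbours x, p, q in K1, each missing fewer
    than m vertices of N(u). By [long_cycle], p and q give a cycle of N(u) - x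
    with at least 2m - 1 vertices; x sees more than half of it. *)
Lemma separated_le K1 K2 : separated K1 K2 -> #|K1| + #|K2| <= 2 * m + 1.
Proof.
wlog le12 : K1 K2 / #|K1| <= #|K2| => [wl sep|sep].
  case: (leqP #|K1| #|K2|) => h; first exact: wl.
  by rewrite addnC; apply: wl (ltnW h) (separated_sym sep).
rewrite leqNgt; apply/negP => lt_m; have [/set0Pn[u uK] _ _ _] := sep.
have [szP missP] := separated_nbh sep uK.
have : 2 < #|nbh u :&: K1| by flia.
case/card_gt2P => x [p [q [[xP pP qP] [xp pq qx]]]].
have mP z : z \in nbh u :&: K1 -> #|[set y in nbh u | ~~ G z y]| < m.
  by move=> /missP; flia.
have inN z : z \in nbh u :&: K1 -> z \in nbh u by rewrite in_setI => /andP[].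
pose X := nbh u :\ x.
have szX : #|nbh u| = #|X|.+1 by rewrite (cardsD1 x) inN.
have XN : X \subset nbh u := subD1set _ _.
have mX z : z \in nbh u :&: K1 -> #|[set y in X | ~~ G z y]| <= m.
  move=> /mP /ltnW; apply: leq_trans; apply: subset_leq_card.
  by apply/subsetP => y; rewrite !inE => /andP[/andP[_ ->]].
have [||w wX|||||c [uc cc cX szc]] := @long_cycle _ G X m p q pq.
- by rewrite !inE eq_sym xp -[G u p]/(true && _); have := inN _ pP; rewrite inE.
- by rewrite !inE qx; have := inN _ qP; rewrite inE.
- by have := degree_in X w; have := nbh_size u; flia.
- exact: mX.
- exact: mX.
- by flia.
- by rewrite -szX nbh_size.
have xc : x \notin c by apply/negP => /cX; rewrite !inE eqxx.
have sub : {subset x :: c <= nbh u}.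
  by move=> z; rewrite inE => /orP[/eqP->|/cX/(subsetP XN)//]; apply: inN.
have := few_nbrs_on_cycle uc cc sub xc szc; have := count_predC (G x) c.
have : count (predC (G x)) c <= #|[set y in nbh u | ~~ G x y]|.
  rewrite -size_filter -(card_uniqP (filter_uniq _ uc)); apply: subset_leq_card.
  apply/subsetP => y; rewrite mem_filter => /andP[/= ny yc].
  by rewrite inE ny sub ?inE ?yc ?orbT.
have := mP x xP; move: (count _ c) (count _ c) szc => n1 n2; flia.
Qed.

(** Adding x to N(x) raises the connectivity by one, just enough for a Hamilton
    path of N(x) + x from x to p. Without its ends it is a path s of at least
    3m - 1 vertices of N(x), and p must miss one of the vertices i and
    i + 2m - 2 of s for each i <= m, otherwise p closes the 2m - 1 vertices
    between them into a wheel rim. *)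
Lemma nonadjacent_many x p : G x p -> m < #|[set z in nbh x | ~~ G p z]|.
Proof.
move=> Gxp; have px : p != x by apply: contraTneq Gxp => ->; rewrite adj_irr.
pose S := x |: nbh x.
have xN : x \notin nbh x by rewrite inE adj_irr.
have szS : #|S| = #|nbh x|.+1 by rewrite cardsU1 xN.
have [||||P [uP sP PS hP lP]] := @ham_connected _ G S m x p _ _ _ _ Gxp.
- move=> K1 K2 _ _ /separated_le; have := nbh_size x; rewrite szS; flia.
- move=> I IS stI; case: (boolP (x \in I)) => [xI|xI].
    suff /subset_leq_card : I \subset [set x] by rewrite cards1; flia.
    apply/subsetP => y yI; have := subsetP IS _ yI; rewrite !inE => /orP[//|].
    by have := stI _ _ xI yI => /negbTE->.
  apply: (@stable_nbh x) => //; apply/subsetP => y yI.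
  have := subsetP IS _ yI; rewrite !inE => /orP[/eqP yx|//].
  by move: xI; rewrite -yx yI.
- by rewrite setU11.
- by rewrite !inE Gxp orbT.
have szP : size P = #|nbh x|.+1 by rewrite -szS -(eq_card PS) (card_uniqP uP).
case: P => [|y P] in uP sP PS hP lP szP *; first by [].
rewrite /= in hP; rewrite {y}hP in uP sP PS lP szP.
case/lastP: P => [|s y] in uP sP PS lP szP *.
  by move: lP px => /= ->; rewrite eqxx.
rewrite /= last_rcons in lP; rewrite {y}lP in uP sP PS szP.
have {}szs : size s = #|nbh x|.-1 by move: szP; rewrite /= size_rcons => -[<-].
have lb := nbh_size x.
have sN : {subset rcons s p <= nbh x}.
  move=> z zs; have : z \in S by rewrite -PS inE zs orbT.
  rewrite in_setU1 => /orP[/eqP zx|//]; move: uP.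
  by rewrite -zx cons_uniq zs.
have us : uniq (rcons s p) by case/andP: uP.
have [ps us'] : p \notin s /\ uniq s by move: us; rewrite rcons_uniq => /andP[].
have ss : sorted G s.
  move: sP => /= /path_sorted; rewrite -cats1 => /cat_sorted2[] //.
have far i : i <= m -> ~~ (G p (nth p s i) && G p (nth p s (i + (2 * m).-2))).
  move=> im; apply/negP => /andP[Gi Gj].
  pose w := take (2 * m).-1 (drop i s).
  have szw : size w = (2 * m).-1 by rewrite size_takel // size_drop; flia.
  have wN z : z \in w -> z \in s by move/mem_take/mem_drop.
  apply: (@no_wheel x (p :: w)).
  - rewrite cons_uniq take_uniq ?drop_uniq // andbT.
    by apply: contra ps => /wN.
  - apply: (sorted_cycle (x0 := p)).
      rewrite -cat1s; apply: (sorted_join (x0 := p)) => //.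
        by apply/take_sorted/drop_sorted.
      by move=> _ _; rewrite head_take ?head_drop //; flia.
    rewrite /= -[last p w]/(last p w) last_take; last by rewrite size_drop; flia.
    rewrite nth_drop adj_sym.
    exact: Gj.
  - by rewrite /= szw; flia.
  move=> z; rewrite inE => /orP[/eqP->|/wN zs]; apply: sN.
    by rewrite mem_rcons mem_head.
  by rewrite mem_rcons inE zs orbT.
pose f (i : 'I_m.+1) : nat := if G p (nth p s i) then i + (2 * m).-2 else i.
have fs i : f i < size s by rewrite /f; have := ltn_ord i; case: ifP; flia.
have fN i : ~~ G p (nth p s (f i)).
  have := far i (ltn_ord i : i <= m); rewrite /f.
  by case: (boolP (G p (nth p s i))).
have inj : injective (fun i => nth p s (f i)).
  move=> i j /eqP; rewrite nth_uniq // => /eqP e; apply: ord_inj.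
  by move: e (ltn_ord i) (ltn_ord j); rewrite /f; case: ifP; case: ifP; flia.
have <- : #|[set nth p s (f i) | i : 'I_m.+1]| = m.+1.
  by rewrite card_imset // card_ord.
apply: subset_leq_card; apply/subsetP => z /imsetP[i _ ->].
by rewrite in_set fN andbT; apply: sN; rewrite mem_rcons inE mem_nth ?orbT.
Qed.

Lemma separated_lt K1 K2 : separated K1 K2 -> #|K1| + #|K2| < 2 * m.
Proof.
wlog le12 : K1 K2 / #|K1| <= #|K2| => [wl sep|sep].
  case: (leqP #|K1| #|K2|) => h; first exact: wl.
  by rewrite addnC; apply: wl (ltnW h) (separated_sym sep).
rewrite ltnNge; apply/negP => le_m; have [/set0Pn[u uK] _ _ _] := sep.
have [szP missP] := separated_nbh sep uK.
have /card_gt0P[p pP] : 0 < #|nbh u :&: K1| by flia.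
have Gup : G u p by move: pP; rewrite !inE => /andP[].
by have := nonadjacent_many Gup; have := missP p pP; flia.
Qed.

Lemma ham_nbh v (S : {set T}) y z :
    S \subset nbh v -> 3 * m <= #|S|.+1 -> y \in S -> z \in S -> G y z ->
  exists P, [/\ uniq P, sorted G P, P =i S, head z P = y & last y P = z].
Proof.
move=> SN szS; apply: (@ham_connected _ _ _ m) => [K1 K2 _ _ /separated_lt|I IS].
  by flia.
by apply: stable_nbh; apply: subset_trans IS SN.
Qed.

Lemma nbh_edge v (S : {set T}) : S \subset nbh v -> m <= #|S| ->
  exists y z, [/\ y \in S, z \in S & G y z].
Proof.
move=> SN szS; case: (pickP [pred yz | [&& yz.1 \in S, yz.2 \in S & G yz.1 yz.2]]).
  by case=> y z /and3P[/= *]; exists y, z.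
move=> none; suff /(stable_nbh SN) : stable S by rewrite ltnNge szS.
by move=> y z yS zS; have := none (y, z); rewrite /= yS zS /= => ->.
Qed.

(** N(v) - p has a Hamilton cycle, and p sees at most half of it. *)
Lemma codegree v p : G v p -> 2 * #|[set z in nbh v | G p z]| < #|nbh v|.
Proof.
move=> Gvp; pose S := nbh v :\ p.
have pN : p \in nbh v by rewrite inE.
have szS : #|nbh v| = #|S|.+1 by rewrite (cardsD1 p) pN.
have lb := nbh_size v; have SN : S \subset nbh v := subD1set _ _.
have [|y [z [yS zS Gyz]]] := nbh_edge SN; first by flia.
have [|P [uP sP PS hP lP]] := ham_nbh SN _ yS zS Gyz; first by flia.
have szP : size P = #|S| by rewrite -(eq_card PS) (card_uniqP uP).
have P0 : 0 < size P by flia.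
rewrite szS -szP ltnS.
have -> : #|[set z in nbh v | G p z]| = count (G p) P.
  rewrite -size_filter -(card_uniqP (filter_uniq _ uP)); apply: eq_card => x.
  rewrite mem_filter PS !inE; case: (eqVneq x p) => [->|_] /=.
    by rewrite adj_irr andbF.
  by rewrite andbC.
apply: (@few_nbrs_on_cycle v) => //; last 2 first.
- by rewrite PS !inE eqxx.
- by flia.
- apply: (sorted_cycle (x0 := y)) => //.
  by move: hP; case: (P) P0 lP => //= a l _ -> ->; rewrite adj_sym.
move=> x; rewrite inE => /orP[/eqP->//|]; rewrite PS; exact: (subsetP SN).
Qed.

Lemma common_nonadjacent u w :
  G u w -> 2 * #|[set z | ~~ G u z & ~~ G w z]| + 3 <= m.
Proof.
move=> Guw; have := codegree Guw; have := missG u; have := missG w.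
rewrite !nbhC.
have -> : [set z in nbh u | G w z] = nbh u :&: nbh w.
  by apply/setP => z; rewrite !inE.
have -> : [set z | ~~ G u z & ~~ G w z] = ~: (nbh u :|: nbh w).
  by apply/setP => z; rewrite !inE negb_or.
have := cardsC (nbh u); have := cardsC (nbh w); have := cardsUI (nbh u) (nbh w).
have := cardsC (nbh u :|: nbh w); flia.
Qed.

(** The path y ... z is closed into a cycle by the edge z y. Suppose that x sees
    its j-th vertex, and let w be the vertex m + 1 positions further on. If w
    were adjacent to y, then from x one could go to the j-th vertex, back to y,
    jump to w, and go on to z and x. If w were adjacent to the vertex after y,
    one could go back only to that vertex, jump to w, and go on to z, y and x.
    Both cycles leave out the m vertices before w and have length 2m. *)
Lemma window v x y z s :
    uniq [:: x, y & rcons s z] -> sorted G (y :: rcons s z) ->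
    {subset [:: x, y & rcons s z] <= nbh v} -> size s + 3 = 3 * m ->
    G x y -> G x z -> G y z ->
  2 * count (G x) (take (2 * m - 3) s) + 3 <= m.
Proof.
set P := y :: rcons s z => uxP sP subN szs Gxy Gxz Gyz.
have [xP uP] : x \notin P /\ uniq P by apply/andP.
have szP : size P = 3 * m - 1 by rewrite /= size_rcons; flia.
have lP d : last d P = z by rewrite /= last_rcons.
have PN p : p \in P -> p \in nbh v by move=> pP; apply: subN; rewrite inE pP orbT.
have [skip0 skip1] : (forall j, 0 < j <= 2 * m - 3 -> G x (nth x P j) ->
      ~~ G (nth x P 0) (nth x P (j + m.+1))) /\
    (forall j, 0 < j <= 2 * m - 3 -> G x (nth x P j) ->
      ~~ G (nth x P 1) (nth x P (j + m.+1))).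
  have main j l : 0 < j <= 2 * m - 3 ->
      perm_eq l (take j.+1 P ++ drop (j + m.+1) P) -> sorted G l ->
      G x (head x l) -> G (last x l) x -> False.
    move=> j0 eql sl hl ll.
    have sub : subseq (take j.+1 P ++ drop (j + m.+1) P) P.
      rewrite -{3}(cat_take_drop j.+1 P); apply: cat_subseq => //.
      have -> : j + m.+1 = m + j.+1 by flia.
      by rewrite -drop_drop; apply: drop_subseq.
    have lsub p : p \in l -> p \in P by rewrite (perm_mem eql); apply: mem_subseq.
    apply: (@no_wheel v (x :: l)).
    - rewrite /= (perm_uniq eql) (subseq_uniq sub uP) andbT.
      by apply: contra xP => /lsub.
    - apply: (sorted_cycle (x0 := x)) => //.
      by rewrite -cat1s; apply: (sorted_join (x0 := x)).
    - rewrite /= (perm_size eql) size_cat size_takel ?size_drop ?szP; flia.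
    move=> p; rewrite inE => /orP[/eqP->|/lsub/PN //].
    by apply: subN; rewrite mem_head.
  split=> j j0 Gj; apply/negP => Ge.
    apply: (@main j (rev (take j.+1 P) ++ drop (j + m.+1) P) j0).
    - by rewrite perm_cat2r perm_rev.
    - apply: (sorted_join (x0 := x)); last by rewrite last_rev head_drop.
        by rewrite rev_sortedG; apply: take_sorted.
      exact: drop_sorted.
    - rewrite -nth0 nth_cat size_rev size_takel ?szP; last by flia.
      by rewrite nth0 head_rev last_take // szP; flia.
    - rewrite last_cat; have lt_j : j + m.+1 < size P by rewrite szP; flia.
      by rewrite (last_drop _ lt_j) lP adj_sym.
  apply: (@main j (rev (drop 1 (take j.+1 P)) ++ drop (j + m.+1) P ++ [:: y]) j0).
  - have eD : take j.+1 P = y :: drop 1 (take j.+1 P) by rewrite /= drop0.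
    move: (drop 1 _) eD => D ->.
    by rewrite catA perm_catC /= perm_cons perm_cat2r perm_rev.
  - have d0 : drop (j + m.+1) P != [::].
      by rewrite -size_eq0 size_drop szP; flia.
    apply: (sorted_join (x0 := x)).
    + by rewrite rev_sortedG; apply/drop_sorted/take_sorted.
    + apply: (sorted_join (x0 := x)) => //; first exact: drop_sorted.
      have lt_j : j + m.+1 < size P by rewrite szP; flia.
      by move=> _ _; rewrite (last_drop _ lt_j) lP adj_sym.
    move=> _ _; rewrite last_rev head_drop nth_take; last by flia.
    rewrite -nth0 nth_cat size_drop szP.
    by case: ifP => [_|]; [rewrite nth_drop addn0 | flia].
  - rewrite -nth0 nth_cat size_rev size_drop size_takel ?szP; last by flia.
    case: ifP => [_|]; last by flia.
    rewrite nth0 head_rev last_drop ?last_take ?size_takel ?szP //; flia.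
  - by rewrite !last_cat /= adj_sym.
have G01 : G (nth x P 0) (nth x P 1).
  by have /(sortedP x) sP' := sP; apply: sP'; rewrite szP; flia.
apply: leq_trans (common_nonadjacent G01).
rewrite leq_add2r leq_mul2l /=.
set ns := [set w | _ & _].
have szt : size (take (2 * m - 3) s) = 2 * m - 3 by rewrite size_takel //; flia.
have szd : size (drop m.+2 P) = 2 * m - 3 by rewrite size_drop szP; flia.
apply: (@leq_trans (count [in ns] (drop m.+2 P))).
  rewrite (count_nth x) (count_nth x _ (drop _ _)) szt szd.
  apply: count_sub_in => i; rewrite mem_iota => /andP[_ /= im] Gi.
  have {}Gi : G x (nth x P i.+1).
    by move: Gi; rewrite nth_take //= nth_rcons ifT //; flia.
  have -> : nth x (drop m.+2 P) i = nth x P (i.+1 + m.+1).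
    by rewrite nth_drop; congr nth; flia.
  suff : nth x P (i.+1 + m.+1) \in ns by [].
  by rewrite in_set; apply/andP; split; [apply: skip0 | apply: skip1] => //; flia.
rewrite -size_filter -(card_uniqP (filter_uniq _ (drop_uniq _ uP))).
by apply: subset_leq_card; apply/subsetP => w; rewrite mem_filter => /andP[].
Qed.

(** The two applications of [window], to the path and to its reverse, cover all
    inner vertices of the path because m <= 2m - 3. *)
Lemma wheel_free_contra : False.
Proof.
have /card_gt0P[v _] : 0 < #|T| by flia.
have [S SN szS] := exists_subset (nbh_size v).
have /card_gt0P[x xS] : 0 < #|S| by flia.
have NN : [set z in S | G x z] \subset nbh v.
  by apply/subsetP => z; rewrite inE => /andP[/(subsetP SN)].
have lb := degree_in S x.
have [|y [z [yN zN Gyz]]] := nbh_edge NN; first by flia.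
move: yN zN; rewrite !inE => /andP[yS Gxy] /andP[zS Gxz].
pose S' := S :\ x.
have szS' : #|S| = #|S'|.+1 by rewrite (cardsD1 x) xS.
have yS' : y \in S' by rewrite !inE yS andbT; apply: contraTneq Gxy => ->; rewrite adj_irr.
have zS' : z \in S' by rewrite !inE zS andbT; apply: contraTneq Gxz => ->; rewrite adj_irr.
have S'N : S' \subset nbh v := subset_trans (subD1set _ _) SN.
have [|P [uP sP PS hP lP]] := ham_nbh S'N _ yS' zS' Gyz; first by flia.
have szP : size P = #|S'| by rewrite -(eq_card PS) (card_uniqP uP).
have cP : m < count (G x) P.
  have : #|[set w in S | G x w]| <= count (G x) P.
    rewrite -size_filter -(card_uniqP (filter_uniq _ uP)).
    apply: subset_leq_card; apply/subsetP => w; rewrite !inE mem_filter PS !inE.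
    by case/andP=> -> Gxw; rewrite Gxw andbT; apply: contraTneq Gxw => ->;
      rewrite adj_irr.
  by move: (count _ _) => n; flia.
case: P => [|y' P] in uP sP PS hP lP szP cP *; first by [].
rewrite /= in hP; rewrite {y'}hP in uP sP PS lP szP cP.
case/lastP: P => [|s z'] in uP sP PS lP szP cP *.
  by move: lP Gyz => /= ->; rewrite adj_irr.
rewrite /= last_rcons in lP; rewrite {z'}lP in uP sP PS szP cP.
have szs : size s + 3 = 3 * m by move: szP; rewrite /= size_rcons; flia.
have xP : x \notin y :: rcons s z by rewrite PS !inE eqxx.
have subN : {subset [:: x, y & rcons s z] <= nbh v}.
  move=> w; rewrite inE => /orP[/eqP->|]; first exact: (subsetP SN).
  by rewrite PS; apply: (subsetP S'N).
have w1 : 2 * count (G x) (take (2 * m - 3) s) + 3 <= m.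
  by apply: (@window v x y z) => //; rewrite cons_uniq xP uP.
have w2 : 2 * count (G x) (take (2 * m - 3) (rev s)) + 3 <= m.
  have rE : z :: rcons (rev s) y = rev (y :: rcons s z).
    by rewrite rev_cons rev_rcons.
  apply: (@window v x z y); rewrite ?size_rev //; try by rewrite 1?adj_sym.
  - by rewrite rE cons_uniq mem_rev xP rev_uniq uP.
  - by rewrite rE rev_sortedG.
  - move=> w; rewrite rE inE mem_rev => h; apply: subN; by rewrite inE.
have : count (G x) (y :: rcons s z) <=
    (count (G x) (take (2 * m - 3) s)) + count (G x) (take (2 * m - 3) (rev s)) + 2.
  rewrite take_rev count_rev /= -cats1 count_cat /= Gxy Gxz.
  rewrite -[in X in X <= _](cat_take_drop (2 * m - 3) s) count_cat.
  have -> : drop (2 * m - 3) s = drop (m - 3) (drop (size s - (2 * m - 3)) s).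
    by rewrite drop_drop; congr drop; flia.
  have := cat_take_drop (m - 3) (drop (size s - (2 * m - 3)) s).
  move/(congr1 (count (G x))); rewrite count_cat.
  move: (count _ _) (count _ _) (count _ _) (count _ _) => n1 n2 n3 n4; flia.
move: (count _ _) (count _ _) (count _ _) cP w1 w2 => n1 n2 n3; flia.
Qed.

End WheelFree.

End Wheels.

(** * The Ramsey bounds *)

Section RamseyBounds.

Lemma cycle_nth (T : finType) (G : sgraph T) x0 c i :
  cycle G c -> i < size c -> G (nth x0 c i) (nth x0 c (i.+1 %% size c)).
Proof.
case: c => // x p; rewrite [cycle _ _]/= => /(pathP x0) cc ip.
have ip' : i < size (rcons p x) by rewrite size_rcons.
have := cc i ip'; rewrite -rcons_cons nth_rcons ip nth_rcons /=.
move: ip; rewrite /= ltnS leq_eqVlt => /orP[/eqP->|ip].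
  by rewrite ltnn eqxx modnn.
by rewrite ip modn_small.
Qed.

Lemma contains_wheel (T : finType) (G : sgraph T) n v c :
    uniq c -> cycle G c -> size c = n -> {subset c <= nbh G v} ->
  contains G (wheel n).
Proof.
move=> uc cc szc sub.
have inc i : i < n -> nth v c i \in c by rewrite -szc; apply: mem_nth.
have vN i : i < n -> G v (nth v c i) by move=> /inc/sub; rewrite inE.
have edge (i j : 'I_n) : j = ordS i -> G (nth v c i) (nth v c j).
  move=> ->; have := @cycle_nth _ G v c i cc; rewrite szc; apply.
  exact: ltn_ord.
exists (fun u : option 'I_n => if u is Some i then nth v c i else v).
  move=> [i|] [j|] //= e.
  - congr Some; apply: ord_inj; apply/eqP; move/eqP: e.
    by rewrite nth_uniq ?szc.
  - by have := vN i (ltn_ord i); rewrite e adj_irr.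
  - by have := vN j (ltn_ord j); rewrite -e adj_irr.
move=> [i|] [j|] //=; last 2 first.
- by move=> _; rewrite adj_sym; apply: vN.
- by move=> _; apply: vN.
by case/andP=> _ /orP[]/eqP h; [|rewrite adj_sym]; apply: edge.
Qed.

Lemma contains_star (T : finType) (G : sgraph T) n v :
  n.-1 <= #|[set w | complement G v w]| -> contains (complement G) (star n).
Proof.
set A := [set w | _] => szA.
have inA i : i < n.-1 -> nth v (enum A) i \in A.
  by move=> lt_i; rewrite -mem_enum mem_nth // -cardE (leq_trans lt_i).
exists (fun u : 'I_1 + 'I_n.-1 =>
  match u with inl _ => v | inr j => nth v (enum A) j end).
  move=> [i|i] [j|j] //= e; first by rewrite [i]ord1 [j]ord1.
  - by have := inA j (ltn_ord j); rewrite inE -e adj_irr.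
  - by have := inA i (ltn_ord i); rewrite inE e adj_irr.
  congr inr; apply: ord_inj; apply/eqP; move/eqP: e.
  by rewrite nth_uniq ?enum_uniq // -cardE; apply: leq_trans szA.
move=> [i|i] [j|j] // _; last rewrite adj_sym.
  by have := inA j (ltn_ord j); rewrite inE.
by have := inA i (ltn_ord i); rewrite inE.
Qed.

Lemma ramsey_prop_wheel_star m : 2 < m ->
  ramsey_prop (wheel (2 * m)) (star (2 * m)) (5 * m - 1).
Proof.
move=> m3 T G szT.
case: (boolP [exists v, (2 * m).-1 <= #|[set w | complement G v w]|]).
  by case/existsP => v /contains_star; right.
rewrite negb_exists => /forallP nostar; left.
case: (boolP [exists v, [exists t : (2 * m).-tuple T,
    [&& uniq t, cycle G t & all [in nbh G v] t]]]).
  case/existsP => v /existsP[t /and3P[ut ct /allP tN]].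
  by apply: contains_wheel ut ct (size_tuple t) tN.
rewrite negb_exists => /forallP nowheel; exfalso.
apply: (@wheel_free_contra T G m) => // [|v|v c uc cc szc sub].
- by rewrite szT; lia.
- have := nostar v; rewrite -ltnNge => szv.
  have -> : [set w | ~~ G v w] = v |: [set w | complement G v w].
    apply/setP => w; rewrite !inE /= /co_adj eq_sym.
    by case: eqVneq => //= ->; rewrite adj_irr.
  by rewrite cardsU1; move: (_ \notin _) szv; case; lia.
case/negP: (nowheel v); apply/existsP; exists (tcast szc (in_tuple c)).
by rewrite val_tcast /= uc cc; apply/allP.
Qed.

Lemma ramsey_prop_mono (S1 S2 : finType) (G1 : sgraph S1) (G2 : sgraph S2) M N :
  M <= N -> ramsey_prop G1 G2 M -> ramsey_prop G1 G2 N.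
Proof.
move=> MN ramM T G szT; rewrite -szT in MN.
pose h (i : 'I_M) : T := enum_val (widen_ord MN i).
have hinj : injective h.
  by move=> i j /enum_val_inj /(congr1 val) /= e; apply: ord_inj.
pose H := @SGraph _ (relpre h G) (fun x y => adj_sym G (h x) (h y))
  (fun x => adj_irr G (h x)).
case: (ramM _ H (card_ord M)) => [[f finj fG]|[f finj fG]]; [left|right].
  by exists (h \o f) => [|x y /fG]; first exact: inj_comp.
exists (h \o f) => [|x y /fG]; first exact: inj_comp.
by rewrite /= /co_adj /= (inj_eq hinj).
Qed.

Variable m : nat.
Hypothesis m1 : 0 < m.

(** The summands carry the independent set, K_m, and the two sides of
    K_{m-1,m-1}. *)
Definition lower_vertex : finType :=
  ('I_(2 * m).-1 + ('I_m + ('I_m.-1 + 'I_m.-1)))%type.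

Definition lower_adj : rel lower_vertex := fun u v =>
  match u, v with
  | inl _, inl _ => false
  | inl _, inr _ | inr _, inl _ => true
  | inr (inl i), inr (inl j) => i != j
  | inr (inr (inl _)), inr (inr (inr _))
  | inr (inr (inr _)), inr (inr (inl _)) => true
  | _, _ => false
  end.

Lemma lower_sym : symmetric lower_adj.
Proof. by move=> [i|[i|[i|i]]] [j|[j|[j|j]]] //=; rewrite eq_sym. Qed.

Lemma lower_irr : irreflexive lower_adj.
Proof. by move=> [i|[i|[i|i]]] //=; rewrite eqxx. Qed.

Definition lower_graph := SGraph lower_sym lower_irr.

Lemma card_lower : #|lower_vertex| = 5 * m - 3.
Proof. by rewrite !card_sum !card_ord; lia. Qed.

Lemma lower_nonadj u : #|[set v | ~~ lower_graph u v]| <= (2 * m).-1.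
Proof.
pose A := [set (inl i : lower_vertex) | i : 'I_(2 * m).-1].
pose B := [set (inr (inl i) : lower_vertex) | i : 'I_m].
pose C1 := [set (inr (inr (inl i)) : lower_vertex) | i : 'I_m.-1].
pose C2 := [set (inr (inr (inr i)) : lower_vertex) | i : 'I_m.-1].
have szA : #|A| <= (2 * m).-1 by rewrite -[leqRHS]card_ord leq_imset_card.
have szB : #|B| <= m by rewrite -[leqRHS]card_ord leq_imset_card.
have szC1 : #|C1| <= m.-1 by rewrite -[leqRHS]card_ord leq_imset_card.
have szC2 : #|C2| <= m.-1 by rewrite -[leqRHS]card_ord leq_imset_card.
have cardU (X Y : {set lower_vertex}) : #|X :|: Y| <= #|X| + #|Y|.
  exact: leq_card_setU.
case: u => [a|[i|[i|i]]].
- apply: leq_trans szA; apply: subset_leq_card; apply/subsetP => v.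
  by rewrite inE; case: v => //= j _; apply: imset_f.
- pose D : {set lower_vertex} := [set inr (inl i)].
  apply: (@leq_trans #|D :|: (C1 :|: C2)|).
    apply: subset_leq_card; apply/subsetP => v; rewrite !inE.
    case: v => [j|[j|[j|j]]] //=; rewrite ?negbK.
    + by move/eqP->; rewrite eqxx.
    + by move=> _; rewrite imset_f ?orbT.
    + by move=> _; rewrite (imset_f (fun i => inr (inr (inr i)))) ?orbT.
  have szD : #|D| = 1 by apply: cards1.
  by have := cardU D (C1 :|: C2); have := cardU C1 C2; flia.
- apply: (@leq_trans #|B :|: C1|); last by have := cardU B C1; flia.
  apply: subset_leq_card; apply/subsetP => v; rewrite !inE.
  case: v => [j|[j|[j|j]]] //= _; first by rewrite imset_f.
  by rewrite (imset_f (fun i => inr (inr (inl i)))) ?orbT.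
- apply: (@leq_trans #|B :|: C2|); last by have := cardU B C2; flia.
  apply: subset_leq_card; apply/subsetP => v; rewrite !inE.
  case: v => [j|[j|[j|j]]] //= _; first by rewrite imset_f.
  by rewrite (imset_f (fun i => inr (inr (inr i)))) ?orbT.
Qed.

Lemma lower_no_star : ~ contains (complement lower_graph) (star (2 * m)).
Proof.
case=> f finj fG; set c := f (inl ord0).
have : #|f @: setT| <= #|[set v | ~~ lower_graph c v]|.
  apply: subset_leq_card; apply/subsetP => v /imsetP[[i|j] _ ->]; rewrite inE.
    by rewrite [i]ord1 adj_irr.
  by have := fG (inl ord0) (inr j) isT; rewrite /= /co_adj => /andP[].
rewrite card_imset // cardsT card_sum !card_ord; have := lower_nonadj c; flia.
Qed.

(** If the hub is one of the 2m - 1 independent vertices, the rim avoids these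
    and is connected, so it lies within K_m or within K_{m-1,m-1}. Otherwise the
    hub has only m - 1 neighbours outside the independent set, but at least half
    of the rim is there, as the successors of independent vertices are. *)
Lemma lower_no_wheel : ~ contains lower_graph (wheel (2 * m)).
Proof.
case=> f finj fG; pose g i := f (Some i).
have ginj : injective g by move=> i j /finj [].
have szg (I : {set 'I_(2 * m)}) (X : {set lower_vertex}) :
    (forall i, i \in I -> g i \in X) -> #|I| <= #|X|.
  move=> sub; rewrite -(card_imset _ ginj); apply: subset_leq_card.
  by apply/subsetP => v /imsetP[i iI ->]; apply: sub.
have hub i : lower_adj (f None) (g i) by apply: (fG None (Some i)).
have nextS (i : 'I_(2 * m)) : i != ordS i.
  apply/eqP => /(congr1 val) /= e; have := ltn_ord i.
  rewrite leq_eqVlt => /orP[/eqP h|h]; last by move: e; rewrite modn_small //; lia.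
  by move: e; rewrite h modnn; lia.
have rim i : lower_adj (g i) (g (ordS i)).
  by apply: (fG (Some i) (Some (ordS i))); rewrite /= /cycle_adj nextS eqxx.
case eq_u : (f None) => [a|b].
  have gB i : exists x, g i = inr x.
    by have := hub i; rewrite eq_u; case: (g i) => // x; exists x.
  pose isB (v : lower_vertex) := if v is inr (inl _) then true else false.
  have o_lt : 0 < 2 * m by lia.
  pose o := Ordinal o_lt.
  have allB i : isB (g i) = isB (g o).
    case: i => k; elim: k => [|k IH] lt_k; first by congr (isB (g _)); apply: ord_inj.
    have lt_k' : k < 2 * m by lia.
    rewrite -(IH lt_k'); have -> : Ordinal lt_k = ordS (Ordinal lt_k').
      by apply: ord_inj; rewrite /= modn_small.
    have := rim (Ordinal lt_k').
    have [x ->] := gB (Ordinal lt_k'); have [y ->] := gB (ordS (Ordinal lt_k')).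
    by case: x y => [x|[x|x]] [y|[y|y]].
  have bound (S : finType) (h : S -> lower_vertex) :
      (forall i, exists x, g i = h x) -> 2 * m <= #|S|.
    move=> gh; have : #|[set: 'I_(2 * m)]| <= #|h @: [set: S]|.
      by apply: szg => i _; have [x ->] := gh i; apply: imset_f.
    rewrite cardsT card_ord => /leq_trans; apply.
    by rewrite -[leqRHS]cardsT leq_imset_card.
  case isBo : (isB (g o)).
    suff /bound : forall i, exists x : 'I_m, g i = inr (inl x).
      by rewrite card_ord; lia.
    move=> i; have := allB i; rewrite isBo; have [[x|x] ->] := gB i => // _.
    by exists x.
  suff /bound : forall i, exists x : ('I_m.-1 + 'I_m.-1)%type, g i = inr (inr x).
    by rewrite card_sum !card_ord; lia.
  move=> i; have := allB i; rewrite isBo; have [[x|x] ->] := gB i => // _.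
  by exists x.
pose isA (v : lower_vertex) := if v is inl _ then true else false.
pose I := [set i | isA (g i)].
have : #|I| <= #|~: I|.
  rewrite -(card_imset I (@ordS_inj _)); apply: subset_leq_card.
  apply/subsetP => j /imsetP[i]; rewrite !inE => iI ->.
  by have := rim i; case: (g i) iI => // x _; case: (g (ordS i)).
have : #|~: I| <= m.-1.
  have gI i : i \in ~: I -> exists2 x, g i = inr x & lower_adj (inr b) (inr x).
    rewrite !inE; have := hub i; rewrite eq_u; case: (g i) => // x h _.
    by exists x.
  case: b {eq_u} gI => [b|[b|b]] gI.
  - apply: (@leq_trans #|(fun x => inr (inl x) : lower_vertex) @: [set~ b]|).
      apply: szg => i /gI[[x|[x|x]] -> //= bx].
      by apply: imset_f; rewrite !inE eq_sym.
    by apply: leq_trans (leq_imset_card _ _) _; rewrite cardsC1 card_ord.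
  - apply: (@leq_trans #|(fun x => inr (inr (inr x)) : lower_vertex) @: setT|).
      by apply: szg => i /gI[[x|[x|x]] -> //= bx]; apply: imset_f.
    by apply: leq_trans (leq_imset_card _ _) _; rewrite cardsT card_ord.
  - apply: (@leq_trans #|(fun x => inr (inr (inl x)) : lower_vertex) @: setT|).
      by apply: szg => i /gI[[x|[x|x]] -> //= bx]; apply: imset_f.
    by apply: leq_trans (leq_imset_card _ _) _; rewrite cardsT card_ord.
by have := cardsC I; rewrite card_ord; lia.
Qed.

End RamseyBounds.

Lemma ramsey_lower m M : 0 < m ->
  ramsey_prop (wheel (2 * m)) (star (2 * m)) M -> 5 * m - 2 <= M.
Proof.
move=> m0 ramM; case: (leqP M (5 * m - 3)) => [le_M|]; last by lia.
have [] := ramsey_prop_mono le_M ramM (lower_graph m) (card_lower m0).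
  by move/(lower_no_wheel m0).
by move/(lower_no_star m0).
Qed.

Theorem corollary2 (n : nat) (hn : 6 <= n) (n_even : ~~ odd n) :
  is_ramsey_number (wheel n) (star n) ((5 * n) %/ 2 - 2) \/
  is_ramsey_number (wheel n) (star n) ((5 * n) %/ 2 - 1).
Proof.
have def_n : n = 2 * n./2 by rewrite mul2n even_halfK.
move: (n./2) def_n => m def_n; rewrite {n}def_n in hn n_even *.
have m3 : 2 < m by lia.
have m0 : 0 < m by lia.
have -> : 5 * (2 * m) %/ 2 = 5 * m by rewrite mulnCA mulKn.
case: (classic (ramsey_prop (wheel (2 * m)) (star (2 * m)) (5 * m - 2))) => ram.
  left; split=> //; first by lia.
  by move=> M _; apply: ramsey_lower.
right; split; first by lia.
  exact: ramsey_prop_wheel_star.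
move=> M _ ramM; have := ramsey_lower m0 ramM.
rewrite leq_eqVlt => /orP[/eqP e|]; last by lia.
by case: ram; rewrite e.
Qed.
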